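(* Suppose the following statement is true: there exist $\varepsilon>0$ and a constant $K>0$ such that for all $x\ge 3$ and all real-valued completely multiplicative functions $h$ such that $|h(n)|\le 1$ for all $n$ and $h(p)=0$ for all primes $p>x^{\varepsilon}$, we have $$\left|\sum_{n\le x}h(n)\right|\le K\,\frac{x}{\log\log x}\exp\left(\sum_{p\le x}\frac{h(p)}{p}\right).$$ Then there exists $\alpha>0$ such that $$P_x\ll\exp(-x^{\alpha}),$$ where $P_x$ is the probability that $\sum_{n\le x}\frac{f(n)}{n}<0$ for a random completely multiplicative function $f$ with $f(p)=\pm1$ with probabilities $1/2$ independently at each prime $p$.
   Context: Sums over $p$ are over primes. $A\ll B$ (with $B\ge0$) means $|A|\le K'B$ for some absolute constant $K'>0$. *)

(* Defs.v *)
From HB Require Import structures.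
From mathcomp Require Import all_boot all_order all_algebra finmap.
From mathcomp Require Import all_classical all_reals all_analysis.
Import Order.TTheory GRing.Theory Num.Theory.

Set Implicit Arguments.
Unset Strict Implicit.
Unset Printing Implicit Defensive.

Local Open Scope classical_set_scope.
Local Open Scope ring_scope.

(* Arithmetic functions live on the positive integers: the value at 0 is
   unconstrained here, and every sum below starts at 1. *)
Definition completely_multiplicative (R : realType) (h : nat -> R) : Prop :=
  h 1%N = 1 /\
  forall m n : nat, (0 < m)%N -> (0 < n)%N -> h (m * n)%N = h m * h n.

(* For x >= 0 the range 1 <= n < (Num.truncn x).+1 is 1 <= n <= x. *)
Definition sum_upto (R : realType) (x : R) (F : nat -> R) : R :=
  \sum_(1 <= n < (Num.truncn x).+1) F n.

Definition prime_sum_upto (R : realType) (x : R) (F : nat -> R) : R :=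
  \sum_(1 <= p < (Num.truncn x).+1 | prime p) F p.

Definition mutually_independent (d : measure_display) (T : measurableType d)
    (R : realType) (P : probability T R) (D : set nat)
    (X : nat -> {RV P >-> R}) : Prop :=
  forall (A : {fset nat}) (B : nat -> set R),
    [set` A] `<=` D ->
    (forall i, i \in A -> measurable (B i)) ->
    (P (\bigcap_(i in [set` A]) (X i @^-1` B i)) =
     \prod_(i <- A) P (X i @^-1` B i))%E.

Record random_sign_cm (d : measure_display) (T : measurableType d)
    (R : realType) (P : probability T R) (f : nat -> {RV P >-> R}) : Prop :=
  RandomSignCM {
    rscm_mult : forall w : T, completely_multiplicative (fun n => f n w);
    rscm_pos : forall p, prime p ->
      P [set w | f p w = 1] = ((2%:R : R)^-1)%:E;
    rscm_neg : forall p, prime p ->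
      P [set w | f p w = -1] = ((2%:R : R)^-1)%:E;
    rscm_indep : mutually_independent [set p | prime p] f
  }.

Definition prob_negative (d : measure_display) (T : measurableType d)
    (R : realType) (P : probability T R) (f : nat -> {RV P >-> R}) (x : R)
    : \bar R :=
  P [set w | sum_upto x (fun n => f n w / n%:R) < 0].

(* Main.v *)
Require Import Defs.
From HB Require Import structures.
From mathcomp Require Import all_boot all_order all_algebra finmap.
From mathcomp Require Import all_classical all_reals all_analysis.
From mathcomp Require Import ring lra zify.
Import Order.TTheory GRing.Theory Num.Theory.

(** Let [h] be the restriction of [f] to [Y]-smooth numbers, where [Y] is a
small power of [x], let [S] be the sum of [h p / p] over [p <= Y], and let
[g = 1 * h >= 0]. With [N = truncn x], the Cesaro mean of [g] satisfies
  [2 sum_(n <= N) g n (N - n)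
     = N^2 sum_(d <= N) h d / d - N sum_(d <= N) h d + sum_(d <= N) h d rho(d)]
with [rho(d+1) - rho(d) = O(N / d)]. The sharp cutoff would produce the
fractional parts [{N / d}] instead of [rho(d)], and these are too rough at small
[d]; with [rho], partial summation and the mean value hypothesis bound the last
two sums by [o(N^2 exp S)]. The left-hand side is [>> N^2 exp S] by elementary
estimates of Chebyshev and Mertens type, so the logarithmic sum of [h] is
[>> exp S >> Y^(-1/8)]. Finally the random signs at the primes in [(Y, x]] are
revealed in increasing order: by the Azuma-Hoeffding argument the sum moves by
[Y^(-1/8)] with probability at most [exp (- Y^b)], since the sum of
[(ln x / p)^2] over [p > Y] is [O((ln x)^2 / Y)]. *)

Set Implicit Arguments.
Unset Strict Implicit.
Unset Printing Implicit Defensive.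

Local Open Scope classical_set_scope.
Local Open Scope ring_scope.

(** All bounds for [h] hold for every choice of its values in [[-1, 1]] at the primes up to [Y];
    only the signs above [Y] have to be averaged. As [exp S] may be small, the error must be
    relative: the hypothesis is useful because its bound carries the factor [exp S] of the main
    term, divided by [ln ln x]. It applies only from a fixed power of [Y] on. Below that the trivial
    bound is used, harmless because [x] is a still larger power of [Y]; the loss [ln N / ln Y] in
    the lower bound for [g] is bounded for the same reason. A loss [Y^(-1/8)] is affordable since
    the random fluctuation has size about [Y^(-1/2) ln x]. No conditional expectation is formed: up
    to a null set the event depends on finitely many signs, and the exponential moment is a finite
    sum over sign patterns. An integer [W] near [x^(1/(16 k))] replaces real powers: [Y = W^16],
    [Y^(-1/8) = W^(-2)], and the exponential parameter is [W^8 = Y^(1/2)]. *)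

(** * Divisor sums of completely multiplicative functions *)

Section DivisorSums.
Variable R : realType.
Implicit Types (F h w : nat -> R) (d m n p N : nat).

Lemma sum_multiples F d N : (0 < d)%N ->
  \sum_(1 <= n < N.+1 | (d %| n)%N) F n = \sum_(1 <= m < (N %/ d).+1) F (d * m)%N.
Proof.
move=> d0; elim: N => [|N IH]; first by rewrite div0n !big_geq.
rewrite big_mkcond big_nat_recr //= -big_mkcond IH divnS //.
case: ifPn => [dN|_]; last by rewrite addr0.
rewrite /= add1n [in RHS]big_nat_recr //=; congr (_ + F _).
by have := divnS N d0; rewrite dN add1n => <-; rewrite mulnC divnK.
Qed.

Lemma sum_not_dvd F p N : \sum_(1 <= n < N.+1) F n =
  \sum_(1 <= n < N.+1 | ~~ (p %| n)%N) F n + \sum_(1 <= n < N.+1 | (p %| n)%N) F n.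
Proof. by rewrite addrC; exact: bigID. Qed.

Definition divsum h n := \sum_(1 <= d < n.+1 | (d %| n)%N) h d.

Lemma sum_widen (P : pred nat) F n N : (n <= N)%N -> (forall d, P d -> (d <= n)%N) ->
  \sum_(1 <= d < n.+1 | P d) F d = \sum_(1 <= d < N.+1 | P d) F d.
Proof.
move=> nN Pn; rewrite [RHS](big_cat_nat (n := n.+1)) //=.
rewrite [X in _ + X]big_nat_cond [X in _ + X]big_pred0 ?addr0 // => d.
by apply/negP => /andP[/andP[nd _]] /Pn; rewrite leqNgt nd.
Qed.

Lemma sum_divsum h w N : \sum_(1 <= n < N.+1) divsum h n * w n =
  \sum_(1 <= d < N.+1) h d * \sum_(1 <= m < (N %/ d).+1) w (d * m)%N.
Proof.
rewrite (eq_big_nat _ _ (F2 := fun n => \sum_(1 <= d < N.+1 | (d %| n)%N) h d * w n)).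
  rewrite (exchange_big_dep_nat xpredT) //=.
  by apply: eq_big_nat => d /andP[d0 _]; rewrite -sum_multiples // mulr_sumr.
move=> n /andP[n0 nN]; rewrite -big_distrl /=; congr (_ * _).
by apply: sum_widen => // d /dvdn_leq; exact.
Qed.

(** A divisor of [p * n] is either prime to [p], hence a divisor of [n], or [p] times an arbitrary
    divisor of [n]. *)
Lemma divsum_mulp h p n : completely_multiplicative h -> prime p -> (0 < n)%N ->
  divsum h (p * n) =
  \sum_(1 <= d < n.+1 | (d %| n)%N && ~~ (p %| d)%N) h d + h p * divsum h n.
Proof.
move=> [h1 hM] pp n0; have p0 := prime_gt0 pp.
rewrite /divsum [LHS]big_mkcond (sum_not_dvd _ p) sum_multiples // mulKn //.
congr (_ + _); last first.
  rewrite mulr_sumr [RHS]big_mkcond; apply: eq_big_nat => d /andP[d0 _].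
  by rewrite dvdn_pmul2l //; case: ifP => // _; rewrite hM.
rewrite [RHS](@sum_widen _ _ _ (p * n)%N) ?leq_pmull //; last first.
  by move=> d /andP[/(dvdn_leq n0)].
rewrite -big_mkcondr; apply: eq_bigl => d; rewrite andbC.
by case: (boolP (p %| d)%N) => pd; rewrite ?andbF // !andbT Gauss_dvdr // coprime_sym prime_coprime.
Qed.

Lemma cm_ind h (P : nat -> R -> Prop) : completely_multiplicative h ->
  P 1%N 1 ->
  (forall p n, prime p -> (0 < n)%N -> P n (h n) -> P (p * n)%N (h p * h n)) ->
  forall n, (0 < n)%N -> P n (h n).
Proof.
move=> [h1 hM] P1 PM; elim/ltn_ind => n IH n0.
have [n1|n1] := leqP n 1.
  by have -> : n = 1%N by [apply/eqP; rewrite eqn_leq n1]; rewrite h1.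
have pp := pdiv_prime n1; have pn := pdiv_dvd n.
rewrite -(divnK pn) mulnC; have m0 : (0 < n %/ pdiv n)%N by rewrite divn_gt0 ?pdiv_gt0 // dvdn_leq.
rewrite hM ?pdiv_gt0 //; apply: PM => //; apply: IH => //.
by rewrite ltn_Pdiv // prime_gt1.
Qed.

Lemma cm_norm_le1 h : completely_multiplicative h ->
  (forall p, prime p -> `|h p| <= 1) -> forall n, (0 < n)%N -> `|h n| <= 1.
Proof.
move=> hh hp; apply: (cm_ind (P := fun _ y => `|y| <= 1)) => //; first by rewrite normr1.
by move=> p n pp _ hn; rewrite normrM -[1]mulr1 ler_pM // hp.
Qed.

Lemma cm_ge0 h : completely_multiplicative h ->
  (forall p, prime p -> 0 <= h p) -> forall n, (0 < n)%N -> 0 <= h n.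
Proof.
move=> hh hp; apply: (cm_ind (P := fun _ y => 0 <= y)) => //.
by move=> p n pp _ hn; rewrite mulr_ge0 // hp.
Qed.

Lemma eq_cm h1 h2 n : completely_multiplicative h1 -> completely_multiplicative h2 ->
  (0 < n)%N -> (forall p, prime p -> (p %| n)%N -> h1 p = h2 p) -> h1 n = h2 n.
Proof.
move=> hh1 hh2 n0.
apply: (cm_ind (P := fun n y => (forall p, prime p -> (p %| n)%N -> h1 p = h2 p) ->
  y = h2 n) hh1) => // [_|p m pp m0 IH hp]; first by case: hh2 => ->.
rewrite (hh2.2 _ _ (prime_gt0 pp) m0) -IH ?(hp p pp) ?dvdn_mulr // => q qq qm.
by rewrite hp // dvdn_mull.
Qed.

Lemma divsum_mulp_notin h p n : completely_multiplicative h -> prime p -> (0 < n)%N ->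
  (p %| n)%N = false -> divsum h (p * n) = (1 + h p) * divsum h n.
Proof.
move=> hh pp n0 pn; rewrite divsum_mulp // mulrDl mul1r; congr (_ + _).
apply: eq_bigl => d; case: (boolP (d %| n)%N) => //= dn.
by apply/negP => pd; rewrite (dvdn_trans pd dn) in pn.
Qed.

Lemma divsum_mulp_eq0 h p n : completely_multiplicative h -> prime p -> (0 < n)%N ->
  h p = 0 -> divsum h (p * n) = divsum h n.
Proof.
move=> hh pp n0 hp0; rewrite divsum_mulp // hp0 mul0r addr0.
rewrite /divsum big_mkcond [RHS]big_mkcond; apply: eq_big_nat => d /andP[d0 _].
case: (d %| n)%N => //=.
case: (boolP (p %| d)%N) => //= /dvdnP[m md].
by move: d0; rewrite md muln_gt0 => /andP[m0 _]; rewrite (hh.2 _ _ m0 (prime_gt0 pp)) hp0 mulr0.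
Qed.

(** The local factor at [p] is [u k = 1 + h p + ... + (h p)^k]. Its terms are nonnegative if
    [h p >= 0]; if [-1 <= h p < 0], the recursion [u (k + 1) = 1 + h p * u k] keeps it in
    [[0, 1]]. *)
Lemma divsum_ge0 h n : completely_multiplicative h -> (forall p, prime p -> `|h p| <= 1) ->
  (0 < n)%N -> 0 <= divsum h n.
Proof.
move=> hh hp; elim/ltn_ind: n => n IH n0.
have [n1|n1] := leqP n 1.
  have -> : n = 1%N by apply/eqP; rewrite eqn_leq n1.
  by rewrite /divsum big_mkcond big_nat1 /= hh.1.
set p := pdiv n; have pp : prime p := pdiv_prime n1.
have [m pm nE] := pfactor_coprime pp n0.
have m0 : (0 < m)%N by rewrite lt0n; apply: contraTneq n0 => m0; rewrite nE m0.
have pdm : (p %| m)%N = false by apply/negbTE; rewrite -prime_coprime.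
have lt_mn : (m < n)%N.
  rewrite [X in (_ < X)%N]nE -{1}[m]muln1 ltn_pmul2l //; apply: (leq_trans (prime_gt1 pp)).
  by rewrite -{1}[p]expn1 leq_exp2l ?prime_gt1 // logn_gt0 mem_primes pp n0 pdiv_dvd.
have gm := IH _ lt_mn m0.
pose u k := \sum_(i < k.+1) h p ^+ i.
have uS k : u k.+1 = 1 + h p * u k.
  by rewrite /u big_ord_recl expr0 mulr_sumr; congr (_ + _); apply: eq_bigr => i _; rewrite exprS.
have gE k : divsum h (p ^ k * m) = u k * divsum h m.
  elim: k => [|k IHk]; first by rewrite /u big_ord1 expn0 mul1n mul1r.
  have pkm : (0 < p ^ k * m)%N by rewrite muln_gt0 expn_gt0 m0 (prime_gt0 pp).
  rewrite expnS -mulnA divsum_mulp // IHk uS mulrDl mul1r mulrA.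
  congr (_ + _); rewrite /divsum [RHS](@sum_widen _ _ _ (p ^ k * m)%N); last 2 first.
  - by rewrite leq_pmull // expn_gt0 prime_gt0.
  - by move=> d; apply: dvdn_leq.
  apply: eq_bigl => d; case: (boolP (p %| d)%N) => pd; rewrite ?andbT ?andbF.
    by apply/esym/negP => dm; rewrite (dvdn_trans pd dm) in pdm.
  by rewrite Gauss_dvdr // coprimeXr // coprime_sym prime_coprime.
rewrite nE mulnC gE mulr_ge0 //; have := hp _ pp; rewrite ler_norml => /andP[hpm hp1].
have [h0|h0] := leP 0 (h p); first by apply: sumr_ge0 => i _; apply: exprn_ge0.
have : forall k, 0 <= u k <= 1.
  elim=> [|k /andP[u0 u1]]; first by rewrite /u big_ord1 expr0; apply/andP.
  by rewrite uS; apply/andP; split; nra.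
by move=> /(_ (logn p n)) /andP[].
Qed.

Definition cm_ext (s : nat -> R) n := \prod_(0 <= p < n.+1 | prime p) s p ^+ logn p n.

Lemma cm_extE s n B : (0 < n)%N -> (n < B)%N ->
  cm_ext s n = \prod_(0 <= p < B | prime p) s p ^+ logn p n.
Proof.
move=> n0 nB; rewrite /cm_ext [RHS](big_cat_nat (n := n.+1)) //=.
rewrite [X in _ * X]big_nat_cond [X in _ * X]big1 ?mulr1 // => p /andP[/andP[np _] pp].
by rewrite lognE pp n0 gtnNdvd.
Qed.

Lemma cm_ext_cm s : completely_multiplicative (cm_ext s).
Proof.
split=> [|m n m0 n0].
  by rewrite /cm_ext big1 // => p _; rewrite logn1.
rewrite !(@cm_extE _ _ (m * n).+1) ?muln_gt0 ?m0 ?ltnS ?leq_pmull ?leq_pmulr //.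
by rewrite -big_split; apply: eq_bigr => p _; rewrite lognM // exprD.
Qed.

Lemma cm_ext_prime s p : prime p -> cm_ext s p = s p.
Proof.
move=> pp; rewrite /cm_ext big_mkcond big_nat_recr //= pp logn_prime // eqxx expr1 -big_mkcond big1_seq ?mul1r //.
move=> q /andP[qq]; rewrite mem_index_iota => /andP[_ qp].
by rewrite logn_prime // -(eq_sym p) gtn_eqF.
Qed.

End DivisorSums.

(** * The Cesaro identity and the regularity of its error term *)

Section CesaroIdentity.
Variable R : realType.
Implicit Types (h : nat -> R) (d m n N : nat).

Definition rho d N : R := (N %% d)%:R * (d%:R - (N %% d)%:R) / d%:R.

Lemma sum_gauss q : \sum_(1 <= m < q.+1) m%:R = q%:R * (q%:R + 1) / 2%:R :> R.
Proof.
elim: q => [|q IH]; first by rewrite big_geq // mul0r mul0r.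
by rewrite big_nat_recr //= IH -[in RHS]natr1 -natr1; field.
Qed.

Lemma sum_cesaro d N : (0 < d)%N ->
  2%:R * \sum_(1 <= m < (N %/ d).+1) (N%:R - (d * m)%:R) =
  N%:R ^+ 2 / d%:R - N%:R + rho d N :> R.
Proof.
move=> d0; have d0' : d%:R != 0 :> R by rewrite pnatr_eq0 -lt0n.
under eq_bigr do rewrite natrM.
rewrite sumrB -mulr_sumr sum_gauss big_const_nat iter_addr addr0 subn1 /= -[N%:R *+ _]mulr_natl.
rewrite /rho; have NE : N%:R = (N %/ d)%:R * d%:R + (N %% d)%:R :> R.
  by rewrite -natrM -natrD -divn_eq.
rewrite [in LHS]NE [N%:R in RHS]NE; field; rewrite ?d0' //.
Qed.

Lemma cesaro_identity h N :
  2%:R * \sum_(1 <= n < N.+1) divsum h n * (N%:R - n%:R) =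
  N%:R ^+ 2 * (\sum_(1 <= d < N.+1) h d / d%:R) - N%:R * (\sum_(1 <= d < N.+1) h d)
  + \sum_(1 <= d < N.+1) h d * rho d N.
Proof.
rewrite (sum_divsum h (fun n => N%:R - n%:R)) !mulr_sumr -sumrB -big_split /=.
apply: eq_big_nat => d /andP[d0 _].
by rewrite mulrCA sum_cesaro //; ring.
Qed.

Lemma rho_ge0 d N : (0 < d)%N -> 0 <= rho d N.
Proof.
by move=> d0; rewrite /rho divr_ge0 ?mulr_ge0 // subr_ge0 ler_nat ltnW // ltn_mod.
Qed.

Lemma rho_le d N : (0 < d)%N ->
  rho d N <= (N %% d)%:R /\ rho d N <= d%:R - (N %% d)%:R.
Proof.
move=> d0; have d0' : 0 < d%:R :> R by rewrite ltr0n.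
have r0 : 0 <= (N %% d)%:R :> R by [].
have rd : (N %% d)%:R <= d%:R :> R by rewrite ler_nat ltnW // ltn_mod.
by split; rewrite /rho ler_pdivrMr //; nra.
Qed.

(* [rho d N = d * psi (N / d)] with [psi t = {t}(1 - {t})] 1-Lipschitz. *)
Lemma rho_diff d N : (0 < d)%N -> (d < N)%N ->
  `|rho d.+1 N - rho d N| <= 4%:R * N%:R / d%:R.
Proof.
move=> d0 dN; have d0' : 0 < d%:R :> R by rewrite ltr0n.
have qN : (N %/ d)%:R <= N%:R / d%:R :> R.
  by rewrite ler_pdivlMr // -natrM ler_nat leq_divM.
have N1 : 1 <= N%:R / d%:R :> R by rewrite ler_pdivlMr // mul1r ler_nat ltnW.
rewrite -mulrA; set x := N%:R / d%:R in qN N1 *.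
(* With a common quotient [q], the remainder drops by exactly [q] from [d] to [d + 1], and the
   difference is an explicit expression of size at most [q + 1]. *)
have [qq|qq] := eqVneq (N %/ d.+1)%N (N %/ d)%N.
  have rE : (N %% d = N %/ d + N %% d.+1)%N.
    by have := divn_eq N d; have := divn_eq N d.+1; rewrite qq; lia.
  have rd : (N %% d)%:R <= d%:R :> R by rewrite ler_nat ltnW // ltn_mod.
  rewrite /rho -[d.+1%:R]natr1; move: rd qN; rewrite rE natrD.
  set q := (N %/ d)%:R; set r := (N %% d.+1)%:R; set D := d%:R in d0' * => rd qx.
  have r0 : 0 <= r by []. have q0 : 0 <= q by [].
  have -> : r * (D + 1 - r) / (D + 1) - (q + r) * (D - (q + r)) / D =
     - q + q * ((q + 2%:R * r) / D) + r / D * (r / (D + 1)).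
    by field; rewrite !gt_eqF // ltr_wpDr.
  have : 0 <= (q + 2%:R * r) / D <= 2%:R.
    by rewrite divr_ge0 ?addr_ge0 ?mulr_ge0 ?(ltW d0') //= ler_pdivrMr //; lra.
  have : 0 <= r / D <= 1.
    by rewrite divr_ge0 ?(ltW d0') //= ler_pdivrMr //; lra.
  have : 0 <= r / (D + 1) <= 1.
    by rewrite divr_ge0 ?addr_ge0 ?(ltW d0') //= ler_pdivrMr ?ltr_wpDr //; lra.
  move: (r / (D + 1)) (r / D) ((q + 2%:R * r) / D) => a b c /andP[a0 a1] /andP[b0 b1] /andP[c0 c2].
  have ab1 : a * b <= 1 by rewrite mulr_ile1.
  rewrite ler_norml; apply/andP; split; nra.
(* When the quotient jumps, both ratios are close to an integer: [N %% d] and [d + 1 - N %% d.+1]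
   are at most [N %/ d], so each [rho] is small by itself. *)
have lt_qq : (N %/ d.+1 < N %/ d)%N by rewrite ltn_neqAle qq leq_div2l.
have [_ r1] := rho_le N (ltn0Sn d); have [r2 _] := rho_le N d0.
have := rho_ge0 N (ltn0Sn d); have := rho_ge0 N d0.
have : (N %% d)%:R <= (N %/ d)%:R :> R.
  rewrite ler_nat; have := divn_eq N d; have := divn_eq N d.+1.
  by have := ltn_pmod N (ltn0Sn d); nia.
have : d.+1%:R - (N %% d.+1)%:R <= (N %/ d)%:R :> R.
  rewrite lerBlDr -natrD ler_nat; have := divn_eq N d; have := divn_eq N d.+1.
  by have := ltn_pmod N (ltn0Sn d); nia.
by move=> *; rewrite ler_norml; apply/andP; split; lra.
Qed.

Lemma abel_summation (a b : nat -> R) N :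
  \sum_(1 <= d < N.+1) a d * b d = (\sum_(1 <= d < N.+1) a d) * b N
  - \sum_(1 <= d < N) (\sum_(1 <= e < d.+1) a e) * (b d.+1 - b d).
Proof.
elim: N => [|N IH]; first by rewrite !big_geq // mul0r subr0.
rewrite big_nat_recr //= IH; case: N IH => [|N] IH.
  by rewrite big_nat1 !big_geq // mul0r; ring.
rewrite [X in _ = X * _ - _]big_nat_recr //= [X in _ = _ - X]big_nat_recr //=.
move: (\sum_(1 <= d < N.+2) a d) (\sum_(1 <= d < N.+1) _) => u v; ring.
Qed.

(** Partial summation leaves no boundary term because [rho N N = 0], and the factor [d] in the bound
    for the partial sums cancels the [1 / d] of [rho_diff]. *)
Lemma rho_sum_le h N (M : nat -> R) : (0 < N)%N ->
  (forall d, (0 < d < N)%N -> `|\sum_(1 <= e < d.+1) h e| <= M d * d%:R) ->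
  `|\sum_(1 <= d < N.+1) h d * rho d N| <= 4%:R * N%:R * \sum_(1 <= d < N) M d.
Proof.
move=> N0 hM; rewrite abel_summation {1}/rho modnn mul0r mul0r mulr0 sub0r normrN.
apply: (le_trans (ler_norm_sum _ _ _)); rewrite mulr_sumr.
rewrite big_nat_cond [leRHS]big_nat_cond; apply: ler_sum => d /andP[/andP[d0 dN] _].
have d0' : 0 < d%:R :> R by rewrite ltr0n.
rewrite normrM; apply: (@le_trans _ _ (M d * d%:R * (4%:R * N%:R / d%:R))).
  by apply: ler_pM => //; [apply: hM; rewrite d0|apply: rho_diff].
by rewrite le_eqVlt; apply/orP; left; apply/eqP; field; rewrite gt_eqF.
Qed.
End CesaroIdentity.

(** * Completely multiplicative functions cut off at a prime *)

Section TruncatedCM.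
Variable R : realType.
Implicit Types (s w : nat -> R) (k n m p N : nat).

(** Used in three ways: as the smooth restriction [h], as the indicator of [k]-smooth numbers when
    [s] is [1], and as the stage at which the signs up to [k] have been revealed. *)
Definition cm_trunc s k := cm_ext (fun p => if (p <= k)%N then s p else 0).

Lemma cm_trunc_cm s k : completely_multiplicative (cm_trunc s k).
Proof. exact: cm_ext_cm. Qed.

Lemma cm_trunc_prime s k p : prime p -> cm_trunc s k p = if (p <= k)%N then s p else 0.
Proof. exact: cm_ext_prime. Qed.

Lemma cm_trunc_norm_le1 s k : (forall p, prime p -> `|s p| <= 1) ->
  forall n, (0 < n)%N -> `|cm_trunc s k n| <= 1.
Proof.
move=> sp; apply: cm_norm_le1; first exact: cm_trunc_cm.
by move=> p pp; rewrite cm_trunc_prime //; case: ifP => _; rewrite ?normr0 ?sp.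
Qed.

Lemma cm_trunc_ge0 s k : (forall p, prime p -> 0 <= s p) ->
  forall n, (0 < n)%N -> 0 <= cm_trunc s k n.
Proof.
move=> sp; apply: cm_ge0; first exact: cm_trunc_cm.
by move=> p pp; rewrite cm_trunc_prime //; case: ifP => _; rewrite ?sp.
Qed.

Lemma cm_truncS_ndvd s k n : (0 < n)%N -> ~~ (prime k.+1 && (k.+1 %| n)%N) ->
  cm_trunc s k.+1 n = cm_trunc s k n.
Proof.
move=> n0 kn; apply: eq_cm => // [||p pp pn]; try exact: cm_trunc_cm.
rewrite !cm_trunc_prime //; case: (ltngtP p k.+1) => [pk|pk|pk].
- by rewrite -ltnS pk.
- by rewrite leqNgt ltnW.
- by move: kn; rewrite -pk pp pn.
Qed.

Lemma cm_trunc_eq0 s k p n : prime p -> (k < p)%N -> (0 < n)%N -> (p %| n)%N ->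
  cm_trunc s k n = 0.
Proof.
move=> pp kp n0 /dvdnP[m nE]; move: n0; rewrite nE muln_gt0 => /andP[m0 p0].
by rewrite (cm_trunc_cm s k).2 // (cm_trunc_prime _ _ pp) leqNgt kp mulr0.
Qed.

Lemma cm_trunc_le n s k : (0 < n)%N -> (n <= k)%N -> cm_trunc s k n = cm_ext s n.
Proof.
move=> n0 nk; apply: eq_cm => // [||p pp /(dvdn_leq n0) pn].
- exact: cm_trunc_cm.
- exact: cm_ext_cm.
- by rewrite cm_trunc_prime // cm_ext_prime // (leq_trans pn).
Qed.

(** The inner sum again involves [cm_trunc s k.+1], which accounts for all powers of the new prime.
    Applying the identity twice gives an expansion to second order in [s k.+1]. *)
Lemma sum_cm_truncS s k w N : prime k.+1 ->
  \sum_(1 <= n < N.+1) cm_trunc s k.+1 n * w n =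
  \sum_(1 <= n < N.+1) cm_trunc s k n * w n +
  s k.+1 * \sum_(1 <= m < (N %/ k.+1).+1) cm_trunc s k.+1 m * w (k.+1 * m)%N.
Proof.
move=> pk; rewrite (sum_not_dvd _ k.+1) [in RHS](sum_not_dvd _ k.+1).
rewrite [X in _ = _ + X + _]big_nat_cond [X in _ = _ + X + _]big1 => [|n]; last first.
  by move=> /andP[/andP[n0 _] kn]; rewrite (cm_trunc_eq0 s pk (ltnSn k)) ?mul0r.
rewrite addr0; congr (_ + _).
  rewrite big_nat_cond [RHS]big_nat_cond; apply: eq_bigr => n /andP[/andP[n0 _] kn].
  by rewrite cm_truncS_ndvd // pk.
rewrite sum_multiples // mulr_sumr; apply: eq_big_nat => m /andP[m0 _].
by rewrite (cm_trunc_cm s k.+1).2 // cm_trunc_prime // leqnn mulrA.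
Qed.

Lemma sum_cm_truncS_nprime s k w N : prime k.+1 = false ->
  \sum_(1 <= n < N.+1) cm_trunc s k.+1 n * w n =
  \sum_(1 <= n < N.+1) cm_trunc s k n * w n.
Proof.
by move=> pk; apply: eq_big_nat => n /andP[n0 _]; rewrite cm_truncS_ndvd ?pk.
Qed.

Lemma sum_primeS (F : nat -> R) k : \sum_(1 <= p < k.+2 | prime p) F p =
  \sum_(1 <= p < k.+1 | prime p) F p + if prime k.+1 then F k.+1 else 0.
Proof. by rewrite big_mkcond big_nat_recr //= -big_mkcond. Qed.

End TruncatedCM.

(** * Mertens-type bounds for sums over primes *)

Section PrimeSums.
Variable R : realType.
Implicit Types (k n m p N : nat).
Local Notation lnN n := (ln (n%:R : R)).

Lemma ler_lnN m n : (0 < m)%N -> (m <= n)%N -> lnN m <= lnN n.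
Proof. by move=> m0 mn; rewrite ler_ln ?ler_nat // posrE ltr0n // (leq_trans m0). Qed.

Lemma lnN_ge0 n : 0 <= lnN n.
Proof. by case: n => [|n]; [rewrite ln0|rewrite ln_ge0 // ler1n]. Qed.

Lemma lnN_mul m n : (0 < m)%N -> (0 < n)%N -> lnN (m * n) = lnN m + lnN n.
Proof. by move=> m0 n0; rewrite natrM lnM // posrE ltr0n. Qed.

Lemma sum_inv_ge_ln N : lnN N.+1 <= \sum_(1 <= n < N.+1) n%:R^-1.
Proof.
elim: N => [|N IH]; first by rewrite big_geq // ln1.
rewrite big_nat_recr //=; have N0 : 0 < N.+1%:R :> R by rewrite ltr0n.
have -> : N.+2%:R = N.+1%:R * (1 + N.+1%:R^-1) :> R.
  by rewrite mulrDr mulr1 divff ?gt_eqF // natr1.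
rewrite lnM ?posrE ?addr_gt0 ?invr_gt0 // lerD // le_ln1Dx //.
by apply: (@lt_trans _ _ 0); rewrite ?invr_gt0 // oppr_lt0.
Qed.

Lemma sum_inv_le_ln N : (0 < N)%N -> \sum_(1 <= n < N.+1) n%:R^-1 <= 1 + lnN N.
Proof.
elim: N => [//|[|N] IH] _; first by rewrite big_nat1 ln1 invr1 addr0.
rewrite big_nat_recr //= (le_trans (lerD (IH isT) (lexx _))) // -addrA lerD2l.
have N0 : 0 < N.+2%:R :> R by rewrite ltr0n.
have -> : N.+1%:R = N.+2%:R * (1 - N.+2%:R^-1) :> R.
  by rewrite mulrBr mulr1 divff ?gt_eqF // -[in RHS]natr1 addrK.
have i1 : N.+2%:R^-1 < 1 :> R by rewrite invf_lt1 // ltr1n.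
rewrite lnM ?posrE ?subr_gt0 // -addrA gerDl.
by rewrite -(subrr (N.+2%:R^-1 : R)) addrC lerD2l // le_ln1Dx // ltrN2.
Qed.

Definition prime_ln n : R := if prime n then lnN n else 0.

Lemma prime_ln_ge0 n : 0 <= prime_ln n.
Proof. by rewrite /prime_ln; case: ifP => // _; apply: lnN_ge0. Qed.

Lemma divsum_prime_ln n : (0 < n)%N -> divsum prime_ln n <= lnN n.
Proof.
have idcm : completely_multiplicative (fun n => n%:R : R) by split=> // m l _ _; rewrite natrM.
apply: (cm_ind (P := fun n y => divsum prime_ln n <= ln y) idcm) => [|p m pp m0 IH].
  by rewrite /divsum big_mkcond big_nat1 /= /prime_ln ln1.
have p0 := prime_gt0 pp.
rewrite lnM ?posrE ?ltr0n // addrC; apply: (le_trans _ (lerD IH (lexx _))).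
rewrite /divsum [in leRHS](@sum_widen _ _ _ _ (p * m)%N) ?leq_pmull //; last first.
  by move=> d; apply: dvdn_leq.
have -> : lnN p = \sum_(1 <= d < (p * m).+1) if d == p then lnN p else 0.
  by rewrite -big_mkcond big_nat1_eq p0 ltnS leq_pmulr.
rewrite big_mkcond [X in X + _]big_mkcond -big_split /=; apply: ler_sum => d _.
have := prime_ln_ge0 d; have := lnN_ge0 p; rewrite /prime_ln.
case: (eqVneq d p) => [->|dp]; first by case: ifP; case: ifP; case: ifP => *; lra.
case: (boolP (prime d)) => [dd|_]; last by case: ifP; case: ifP => *; lra.
rewrite Euclid_dvdM // dvdn_prime2 // (negbTE dp) /=; by case: ifP => *; lra.
Qed.

(** Summing [ln p] over all pairs [p | n], [n <= N], gives at most [N ln N]; the prime [p <= N] is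
    counted [N %/ p >= N / (2 p)] times. *)
Lemma sum_prime_ln_div N : (0 < N)%N ->
  \sum_(1 <= p < N.+1 | prime p) lnN p / p%:R <= 2%:R * lnN N.
Proof.
move=> N0; have N0' : 0 < N%:R :> R by rewrite ltr0n.
have H : \sum_(1 <= p < N.+1) prime_ln p * (N %/ p)%:R <= N%:R * lnN N.
  have := @sum_divsum R prime_ln (fun=> 1) N.
  under [in X in _ = X]eq_bigr do rewrite sumr_const_nat subn1 /=.
  move=> <-; apply: (@le_trans _ _ (\sum_(1 <= n < N.+1) lnN N)).
    rewrite big_nat_cond [leRHS]big_nat_cond; apply: ler_sum => n /andP[/andP[n0 nN] _].
    by rewrite mulr1 (le_trans (divsum_prime_ln n0)) // ler_lnN.
  by rewrite sumr_const_nat subn1 /= mulr_natl.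
rewrite -(ler_pM2l N0') mulrCA; apply: (le_trans _ (ler_wpM2l _ H)) => //.
rewrite big_mkcond !mulr_sumr big_nat_cond [leRHS]big_nat_cond.
apply: ler_sum => p /andP[/andP[p0 pN] _]; have p0' : 0 < p%:R :> R by rewrite ltr0n.
rewrite /prime_ln; case: ifP => _; last by rewrite mul0r !mulr0.
rewrite mulrCA [leRHS]mulrCA ler_wpM2l ?lnN_ge0 // ler_pdivrMr // -!natrM ler_nat.
have := divn_eq N p; have := ltn_pmod N p0; have : (0 < N %/ p)%N by rewrite divn_gt0.
nia.
Qed.

(** From [e^16] on, [1 / p] is at most [(ln p / p) / 16], and the smaller primes cost only a
    constant. The slope [1 / 8] is the source of [exp S >> Y^(-1/8)]. *)
Lemma sum_prime_inv_le : exists C : R, 0 < C /\ forall N, (0 < N)%N ->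
  \sum_(1 <= p < N.+1 | prime p) p%:R^-1 <= C + 8%:R^-1 * lnN N.
Proof.
pose T := (Num.truncn (expR 16%:R : R)).+1.
have lnT p : (T <= p)%N -> 16%:R <= lnN p.
  move=> Tp; rewrite -[leLHS]expRK ler_ln ?posrE ?expR_gt0 ?ltr0n //; last exact: leq_trans Tp.
  by rewrite (le_trans (ltW (truncnS_gt _))) // ler_nat.
exists T%:R; split=> [|N N0]; first by rewrite ltr0n.
have := sum_prime_ln_div N0; set S := (X in X <= _) => SN.
have -> : 8%:R^-1 * lnN N = 16%:R^-1 * (2%:R * lnN N) by field.
apply: (@le_trans _ _ (T%:R + 16%:R^-1 * S)); last by rewrite lerD2l ler_wpM2l.
have : \sum_(1 <= p < N.+1 | prime p) (if (p < T)%N then 1 else 0) <= T%:R :> R.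
  apply: (@le_trans _ _ (\sum_(0 <= p < T + N.+1) if (p < T)%N then 1 else 0)); last first.
    rewrite -big_mkcond (big_cat_nat (n := T)) ?leq_addr //= [X in _ + X]big_nat_cond.
    rewrite [X in _ + X]big1 => [|p /andP[/andP[Tp _]]]; last by rewrite ltnNge Tp.
    rewrite addr0 big_nat_cond (eq_bigl (fun p => (0 <= p < T)%N)); last first.
      by move=> p /=; rewrite andbb.
    by rewrite -big_nat sumr_const_nat subn0.
  rewrite big_mkcond (big_cat_nat (n := 1%N) (m := 0%N) (p := (T + N.+1)%N)) //=.
  rewrite ler_wpDl ?sumr_ge0 // => [p _|]; first by case: ifP.
  rewrite (big_cat_nat (n := N.+1) (p := (T + N.+1)%N)) ?leq_addl //= ler_wpDr ?sumr_ge0 //.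
    by move=> p _; case: ifP.
  by apply: ler_sum => p _; case: ifP => // _; case: ifP.
move=> cT; apply: le_trans (lerD cT (lexx _)).
rewrite mulr_sumr -big_split [leLHS]big_nat_cond [leRHS]big_nat_cond /=.
apply: ler_sum => p /andP[/andP[p0 _] _]; have p0' : 0 < p%:R :> R by rewrite ltr0n.
case: ltnP => [_|/lnT lp].
  by rewrite ler_wpDr ?invf_le1 ?ler1n // mulr_ge0 // divr_ge0 ?lnN_ge0.
rewrite add0r mulrA ler_pdivlMr // mulVf ?gt_eqF //; lra.
Qed.

Lemma sum_prime_inv_pronic k :
  \sum_(1 <= p < k.+2 | prime p) (p%:R * (p%:R - 1))^-1 <= 1 - k.+1%:R^-1 :> R.
Proof.
elim: k => [|k IH].
  by rewrite big_mkcond big_nat1 /= invr1 subrr.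
rewrite sum_primeS; apply: (le_trans (lerD IH (lexx _))).
have k0 : 0 < k.+1%:R :> R by rewrite ltr0n.
have -> : (k.+2%:R * (k.+2%:R - 1))^-1 = k.+1%:R^-1 - k.+2%:R^-1 :> R.
  rewrite -[k.+2%:R]natr1 addrK; field; rewrite !gt_eqF //; exact: addr_gt0.
case: ifP => _; first by rewrite addrA subrK.
by rewrite addr0 lerD2l lerN2 lef_pV2 ?posrE ?ltr0n // ler_nat.
Qed.

(** A finite Euler product: admitting the prime [p] gives [S <= S' + S / p], with [S'] the previous
    bound, so [S <= S' / (1 - 1 / p)], and [1 / (1 - 1 / p) = 1 + 1 / p + 1 / (p (p - 1))] is
    bounded by an exponential. *)
Lemma sum_smooth_inv_le k N :
  \sum_(1 <= n < N.+1) cm_trunc (fun=> 1 : R) k n * n%:R^-1 <=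
  expR (\sum_(1 <= p < k.+1 | prime p) (p%:R^-1 + (p%:R * (p%:R - 1))^-1)).
Proof.
have T0 j n : (0 < n)%N -> 0 <= cm_trunc (fun=> 1 : R) j n.
  by apply: cm_trunc_ge0.
elim: k => [|k IH].
  rewrite [X in expR X]big_geq // expR0; case: N => [|N]; first by rewrite big_geq.
  rewrite big_ltn // big_nat_cond big1 => [|n /andP[/andP[n1 _] _]]; last first.
    by rewrite (@cm_trunc_eq0 _ _ _ (pdiv n)) ?mul0r ?pdiv_dvd ?pdiv_prime ?pdiv_gt0 // ltnW.
  by rewrite addr0 (cm_trunc_cm _ _).1 invr1 mulr1.
have [pk|pk] := boolP (prime k.+1); last first.
  by rewrite (sum_cm_truncS_nprime _ _ _ (negbTE pk)) sum_primeS (negbTE pk) addr0.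
rewrite sum_primeS pk expRD; set S := (X in X <= _).
have k1 : 1 < k.+1%:R :> R by rewrite ltr1n prime_gt1.
have k0 : 0 < k.+1%:R :> R by rewrite ltr0n.
have HS : S <= expR (\sum_(1 <= p < k.+1 | prime p) (p%:R^-1 + (p%:R * (p%:R - 1))^-1)) + k.+1%:R^-1 * S.
  rewrite {1}/S sum_cm_truncS // mul1r lerD //.
  rewrite (@le_trans _ _ (k.+1%:R^-1 * \sum_(1 <= m < (N %/ k.+1).+1) cm_trunc (fun=> 1) k.+1 m * m%:R^-1)) //.
    rewrite mulr_sumr le_eqVlt; apply/orP; left; apply/eqP; apply: eq_big_nat => m /andP[m0 _].
    by rewrite natrM invfM mulrCA.
  rewrite ler_wpM2l ?invr_ge0 // /S [leRHS](big_cat_nat (n := (N %/ k.+1).+1)) ?ltnS ?leq_div //=.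
  rewrite lerDl big_nat_cond sumr_ge0 // => n /andP[/andP[n0 _] _].
  by rewrite mulr_ge0 ?invr_ge0 // T0 // (leq_trans _ n0).
have E0 := expR_ge0 (\sum_(1 <= p < k.+1 | prime p) (p%:R^-1 + (p%:R * (p%:R - 1))^-1) : R).
have aux (q : R) : 1 < q -> 1 + (q^-1 + (q * (q - 1))^-1) = (1 - q^-1)^-1.
  move=> q1; have q0 : 0 < q by rewrite (lt_trans _ q1).
  by field; rewrite !gt_eqF ?subr_gt0.
have := expR_ge1Dx (k.+1%:R^-1 + (k.+1%:R * (k.+1%:R - 1))^-1 : R).
rewrite aux // => H; apply: (le_trans _ (ler_wpM2l E0 H)).
by rewrite ler_pdivlMr ?subr_gt0 ?invf_lt1 // mulrBr mulr1 lerBlDr [S * _]mulrC.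
Qed.

(** All [n <= N] are [N]-smooth, so the Euler product dominates the harmonic sum; the terms
    [1 / (p (p - 1))] telescope to at most [1]. *)
Lemma sum_prime_inv_ge N : lnN N <= expR (\sum_(1 <= p < N.+1 | prime p) p%:R^-1 + 1).
Proof.
case: N => [|N]; first by rewrite ln0 // expR_ge0.
apply: (le_trans (ler_lnN _ (leqnSn _))) => //.
apply: (le_trans (sum_inv_ge_ln _)).
have -> : \sum_(1 <= n < N.+2) n%:R^-1 =
    \sum_(1 <= n < N.+2) cm_trunc (fun=> 1 : R) N.+1 n * n%:R^-1.
  apply: eq_big_nat => n /andP[n0 nN]; rewrite cm_trunc_le //.
  by rewrite /cm_ext big1 ?mul1r // => p _; rewrite expr1n.
apply: (le_trans (sum_smooth_inv_le _ _)); rewrite ler_expR big_split lerD2l /=.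
by apply: (le_trans (sum_prime_inv_pronic _)); rewrite gerBl invr_ge0.
Qed.

End PrimeSums.

(** * Chebyshev's lower bound by central binomial coefficients *)

Section Chebyshev.
Variable R : realType.
Implicit Types (k n m p N : nat).
Local Notation lnN n := (ln (n%:R : R)).

Lemma expn2_le_central_bin n : (2 ^ n <= 'C(n.*2, n))%N.
Proof.
elim: n => [|n IH]; first by rewrite bin0.
rewrite doubleS binS expnS mul2n -addnn; apply: leq_add; apply: (leq_trans IH).
  by rewrite binS leq_addl.
by case: n {IH} => // n; rewrite binS leq_addr.
Qed.

(** By Legendre's formula the exponent of [p] is a sum over [k] of terms
    [n.*2 %/ p ^ k - 2 (n %/ p ^ k)], each at most [1] and zero once [p ^ k] exceeds [n.*2]. *)
Lemma logn_central_bin p n : prime p -> (0 < n)%N ->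
  (p ^ logn p 'C(n.*2, n) <= n.*2)%N.
Proof.
move=> pp n0; have n20 : (0 < n.*2)%N by rewrite double_gt0.
apply: (leq_trans _ (trunc_logP (prime_gt1 pp) n20)).
rewrite leq_exp2l ?prime_gt1 //; set t := trunc_log p n.*2.
have E : (logn p n.*2`! = logn p 'C(n.*2, n) + (logn p n`! + logn p n`!))%N.
  have nn : (n <= n.*2)%N by rewrite -addnn leq_addl.
  rewrite -(bin_fact nn) -{2}addnn addnK -!lognM ?muln_gt0 ?fact_gt0 ?bin_gt0 ?nn //.
have F : logn p n`! = (\sum_(1 <= k < n.*2.+1) n %/ p ^ k)%N.
  rewrite logn_fact // [RHS](big_cat_nat (n := n.+1)) ?ltnS -?addnn ?leq_addl //=.
  rewrite [X in (_ + X)%N]big_nat_cond [X in (_ + X)%N]big1 ?addn0 // => k /andP[/andP[nk _] _].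
  by rewrite divn_small // (ltn_trans nk) // ltn_expl // prime_gt1.
have : (\sum_(1 <= k < n.*2.+1) n.*2 %/ p ^ k <=
    \sum_(1 <= k < n.*2.+1) ((n %/ p ^ k + n %/ p ^ k) + (k <= t)))%N.
  apply: leq_sum => k _; have pk0 : (0 < p ^ k)%N by rewrite expn_gt0 prime_gt0.
  case: (leqP k t) => kt.
    have := divn_eq n (p ^ k); have := ltn_pmod n pk0.
    have := divn_eq n.*2 (p ^ k); rewrite -!addnn /=; nia.
  rewrite divn_small //; apply: (leq_trans (trunc_log_ltn n.*2 (prime_gt1 pp))).
  by rewrite leq_exp2l // prime_gt1.
rewrite -logn_fact // E !big_split /= -F addnC leq_add2l => /leq_trans; apply.
suff : forall M, (\sum_(1 <= k < M.+1) (k <= t) <= minn t M)%N.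
  by move=> /(_ n.*2) /leq_trans; apply; rewrite geq_minl.
elim=> [|M IH]; first by rewrite big_geq.
by rewrite big_nat_recr //=; move: IH; case: (leqP M.+1 t) => ?; lia.
Qed.

(** In the factorisation of the central binomial coefficient, a prime [p >= s] occurs at most once
    because [s ^ 2] exceeds [n.*2], and each smaller one contributes at most [ln n.*2]. *)
Lemma chebyshev_even n s : (0 < n)%N -> (n.*2 < s ^ 2)%N ->
  n%:R * ln 2%:R <= \sum_(1 <= p < n.*2.+1) prime_ln R p + s%:R * lnN n.*2.
Proof.
move=> n0 ns; set C := 'C(n.*2, n); have n20 : (0 < n.*2)%N by rewrite double_gt0.
have C0 : (0 < C)%N by rewrite bin_gt0 -addnn leq_addl.
have idcm : completely_multiplicative (fun n => n%:R : R) by split=> // m l _ _; rewrite natrM.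
have CE : C%:R = \prod_(0 <= p < C + n.*2.+1 | prime p) p%:R ^+ logn p C :> R.
  have CB : (C < C + n.*2.+1)%N by rewrite addnS ltnS leq_addr.
  rewrite -(cm_extE (fun p => p%:R) C0 CB).
  apply: (eq_cm idcm) => // [|p pp _]; [exact: cm_ext_cm|by rewrite cm_ext_prime].
have lnC : n%:R * ln 2%:R <= lnN C.
  rewrite mulr_natl -lnXn // -natrX ler_ln ?posrE ?ltr0n ?expn_gt0 // ler_nat.
  exact: expn2_le_central_bin.
apply: (le_trans lnC).
have ln_prod (r : seq nat) (P : pred nat) (F : nat -> R) : (forall i, P i -> 0 < F i) ->
    ln (\prod_(i <- r | P i) F i) = \sum_(i <- r | P i) ln (F i).
  move=> F0; elim: r => [|i r IH]; first by rewrite !big_nil ln1.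
  by rewrite !big_cons; case: ifP => // Pi; rewrite lnM ?posrE ?prodr_gt0 ?F0 // IH.
rewrite CE ln_prod => [|p pp]; last by rewrite exprn_gt0 // ltr0n prime_gt0.
apply: (@le_trans _ _ (\sum_(0 <= p < C + n.*2.+1)
  ((if (p < n.*2.+1)%N then prime_ln R p else 0) + (if (p < s)%N then lnN n.*2 else 0)))).
  rewrite big_mkcond; apply: ler_sum => p _; case: ifP => pp; last first.
    by rewrite addr_ge0 //; case: ifP => // _; rewrite ?prime_ln_ge0 ?lnN_ge0.
  have p0 := prime_gt0 pp; have L := logn_central_bin pp n0; rewrite -/C in L.
  rewrite -natrX; have [ps|sp] := ltnP p s.
    apply: (le_trans (ler_lnN _ _ L)); first by rewrite expn_gt0 p0.
    by rewrite lerDr; case: ifP => // _; apply: prime_ln_ge0.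
  rewrite addr0 ltnS; case: (posnP (logn p C)) => [->|lg].
    by rewrite expn0 ln1; case: ifP => // _; apply: prime_ln_ge0.
  have l1 : logn p C = 1%N.
    apply/eqP; rewrite eqn_leq lg andbT leqNgt; apply/negP => l2.
    have : (s ^ 2 <= n.*2)%N.
      apply: leq_trans L; apply: (@leq_trans (p ^ 2)); first by rewrite leq_exp2r.
      by rewrite leq_exp2l // prime_gt1.
    by rewrite leqNgt ns.
  by move: L; rewrite l1 expn1 => ->; rewrite /prime_ln pp.
rewrite big_split /=; apply: lerD.
  rewrite (big_cat_nat (n := n.*2.+1)) ?leq_addl //= [X in _ + X]big_nat_cond.
  rewrite [X in _ + X]big1 => [|p /andP[/andP[np _] _]]; last by rewrite ltnNge np.
  rewrite addr0 big_ltn // /prime_ln /= add0r le_eqVlt; apply/orP; left; apply/eqP.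
  by apply: eq_big_nat => p /andP[_ ->].
apply: (@le_trans _ _ (\sum_(0 <= p < s + (C + n.*2.+1)) if (p < s)%N then lnN n.*2 else 0)).
  rewrite [leRHS](big_cat_nat (n := (C + n.*2.+1)%N)) ?leq_addl //= lerDl sumr_ge0 // => p _.
  by case: ifP => // _; apply: lnN_ge0.
rewrite (big_cat_nat (n := s)) ?leq_addr //= [X in _ + X]big_nat_cond.
rewrite [X in _ + X]big1 => [|p /andP[/andP[np _] _]]; last by rewrite ltnNge np.
rewrite addr0 (eq_big_nat _ _ (F2 := fun=> lnN n.*2)) => [|p /andP[_ ->]] //.
by rewrite sumr_const_nat subn0 mulr_natl.
Qed.

Lemma nat_root k X : (0 < k)%N -> exists u, (u ^ k <= X < u.+1 ^ k)%N.
Proof.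
move=> k0; elim: X => [|X [u /andP[uX Xu]]].
  by exists 0%N; rewrite exp0n // exp1n.
move: Xu; rewrite leq_eqVlt => /orP[/eqP Xu|Xu]; last first.
  by exists u; rewrite Xu (leq_trans uX).
by exists u.+1; rewrite Xu leqnn /= ltn_exp2r.
Qed.

Lemma half_le_ln2 : 2%:R^-1 <= ln 2%:R :> R.
Proof.
have -> : 2%:R = (1 - 2%:R^-1)^-1 :> R by field.
have h2 : 0 < 1 - 2%:R^-1 :> R by lra.
by rewrite lnV ?posrE // lerNr (le_trans (le_ln1Dx _)); lra.
Qed.

Lemma chebyshev : exists X0 : nat, forall X, (X0 <= X)%N ->
  12%:R^-1 * X%:R <= \sum_(1 <= p < X.+1) prime_ln R p.
Proof.
(* With [u] the integer fourth root of [X], one has [ln X <= 4 u]; taking [s = (u + 1)^2], the error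
   is at most [16 u^3], hence at most [u^4 / 12] for [u >= 192]. The equation keeps the numeral
   opaque. *)
have [K KE] : exists K, K = 192%N by exists 192%N.
exists (K ^ 4)%N => X KX.
have [u /andP[uX Xu]] := nat_root X (isT : (0 < 4)%N).
have Ku : (K <= u)%N by rewrite -ltnS -(ltn_exp2r _ _ (isT : (0 < 4)%N)) (leq_ltn_trans KX).
have u0 : (0 < u)%N by apply: leq_trans Ku; rewrite KE.
have u2 : (2 <= u)%N by apply: leq_trans Ku; rewrite KE.
have Ku' : 192%:R <= u%:R :> R by rewrite ler_nat -KE.
clear K KE KX Ku.
have X2 : (2 <= X)%N.
  apply: leq_trans uX; apply: (leq_trans u2).
  by rewrite -{1}[u]expn1 leq_pexp2l.
have nX : ((X./2).*2 <= X)%N by rewrite -[leqRHS]odd_double_half leq_addl.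
have n0 : (0 < X./2)%N by rewrite half_gt0.
have ns : ((X./2).*2 < (u.+1 ^ 2) ^ 2)%N by rewrite -expnM (leq_ltn_trans nX).
have := chebyshev_even n0 ns.
have : \sum_(1 <= p < (X./2).*2.+1) prime_ln R p <= \sum_(1 <= p < X.+1) prime_ln R p.
  rewrite [leRHS](big_cat_nat (n := (X./2).*2.+1)) //= lerDl sumr_ge0 // => p _.
  exact: prime_ln_ge0.
set th := \sum_(1 <= p < X.+1) _; set th' := \sum_(1 <= p < _) _ => th_le che.
have lnX : lnN (X./2).*2 <= 4%:R * u%:R.
  apply: (@le_trans _ _ (lnN (u.+1 ^ 4))).
    by apply: ler_lnN; rewrite ?double_gt0 // (leq_trans nX) // ltnW.
  rewrite natrX lnXn // -[leLHS]mulr_natl ler_wpM2l // -natr1 addrC le_ln1Dx //.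
  by apply: (@lt_le_trans _ _ 0).
have nX3 : X%:R <= 3%:R * (X./2)%:R :> R.
  by rewrite -natrM ler_nat; have := odd_double_half X; move: n0; lia.
have s_le : (u.+1 ^ 2)%:R <= 4%:R * u%:R ^+ 2 :> R.
  by rewrite -natrX -natrM ler_nat -!mulnn; nia.
have uX4 : u%:R ^+ 4 <= X%:R :> R by rewrite -natrX ler_nat.
have half := half_le_ln2.
have H1 : (u.+1 ^ 2)%:R * lnN (X./2).*2 <= 16%:R * u%:R ^+ 3.
  apply: (@le_trans _ _ (4%:R * u%:R ^+ 2 * (4%:R * u%:R))).
    by apply: ler_pM => //; rewrite lnN_ge0.
  by rewrite le_eqVlt; apply/orP; left; apply/eqP; ring.
have H2 : 16%:R * u%:R ^+ 3 <= 12%:R^-1 * X%:R :> R.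
  apply: (@le_trans _ _ (12%:R^-1 * (u%:R * u%:R ^+ 3))); last by rewrite -exprS ler_wpM2l.
  have : 0 <= u%:R ^+ 3 :> R by rewrite exprn_ge0.
  by move: (u%:R ^+ 3) => v v0; nra.
have H3 : 6%:R^-1 * X%:R <= (X./2)%:R * ln 2%:R :> R.
  have := ler_wpM2l (ler0n R (X./2)) half; lra.
lra.
Qed.
End Chebyshev.

(** * Lower bound for the sum of [divsum h] *)

Section DivisorSumLowerBound.
Variable R : realType.
Implicit Types (h a b : nat -> R) (k m n p q N Y Z : nat).
Local Notation lnN n := (ln (n%:R : R)).

Lemma prod_primeS (F : nat -> R) k : \prod_(1 <= p < k.+2 | prime p) F p =
  \prod_(1 <= p < k.+1 | prime p) F p * if prime k.+1 then F k.+1 else 1.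
Proof. by rewrite big_mkcond big_nat_recr //= -big_mkcond. Qed.

Lemma dirichlet_swap a b N :
  \sum_(1 <= d < N.+1) a d * \sum_(1 <= m < (N %/ d).+1) b m =
  \sum_(1 <= m < N.+1) b m * \sum_(1 <= d < (N %/ m).+1) a d.
Proof.
have E (c e : nat -> R) : \sum_(1 <= d < N.+1) c d * \sum_(1 <= m < (N %/ d).+1) e m =
    \sum_(1 <= d < N.+1) \sum_(1 <= m < N.+1) if (d * m <= N)%N then c d * e m else 0.
  apply: eq_big_nat => d /andP[d0 dN]; rewrite mulr_sumr -big_mkcond /=.
  rewrite -(@sum_widen _ (fun m => d * m <= N)%N _ (N %/ d)%N) ?leq_div //; last first.
    by move=> m; rewrite leq_divRL // mulnC.
  rewrite big_nat_cond [RHS]big_nat_cond; apply: eq_bigl => m.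
  case: (boolP (0 < m < (N %/ d).+1)%N) => //= /andP[_]; rewrite ltnS leq_divRL // mulnC => ->.
  by [].
rewrite !E exchange_big /=; apply: eq_bigr => m _; apply: eq_bigr => d _.
by rewrite mulnC mulrC.
Qed.

Definition smooth k n : R := cm_trunc (fun=> 1) k n.

Lemma smooth_ge0 k n : (0 < n)%N -> 0 <= smooth k n.
Proof. by apply: cm_trunc_ge0. Qed.

Lemma smooth_le1 k n : (0 < n)%N -> smooth k n <= 1.
Proof.
move=> n0; apply: le_trans (ler_norm _) _; apply: cm_trunc_norm_le1 => // *.
by rewrite normr1.
Qed.

Section LogWeight.
Variables (h : nat -> R) (N : nat).
Hypothesis hh : completely_multiplicative h.
Hypothesis hp : forall p, prime p -> `|h p| <= 1.
Hypothesis N0 : (0 < N)%N.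

(** [F k] is the sum of [divsum h m / m] over squarefree [k]-smooth [m], and [B k] bounds the
    average of [ln m] for these weights; so [F k * (L - B k)] bounds from below the sum of the
    weights times [L - ln m]. *)
Let F k := \prod_(1 <= p < k.+1 | prime p) (1 + (1 + h p) / p%:R).
Let B k := \sum_(1 <= p < k.+1 | prime p) (1 + h p) * (lnN p / p%:R).
Let E k L := \sum_(1 <= m < N.+1) smooth k m * (divsum h m / m%:R * Num.max 0 (L - lnN m)).

Let t_ge0 p : prime p -> 0 <= (1 + h p) / p%:R.
Proof.
by move=> /hp; rewrite ler_norml => /andP[hp1 _]; rewrite divr_ge0 //; lra.
Qed.

Let F_ge0 k : 0 <= F k.
Proof. by apply: prodr_ge0 => p /t_ge0 t0; rewrite addr_ge0. Qed.

Let w_ge0 m L : (0 < m)%N -> 0 <= divsum h m / m%:R * Num.max 0 (L - lnN m).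
Proof. by move=> m0; rewrite !mulr_ge0 ?invr_ge0 ?divsum_ge0 // le_max lexx. Qed.

(* The logarithmic weight turns the passage from [k] to a prime [k.+1] into a
   shift of [L], so that truncating at [N] costs only the additive [B k]. *)
Lemma smooth_log_sum_ge k L : L <= lnN N.+1 -> F k * (L - B k) <= E k L.
Proof.
elim: k L => [|k IH] L LN.
  rewrite /F /B [X in X * _]big_geq // [X in _ - X]big_geq // mul1r subr0 /E big_ltn ?ltnS //.
  rewrite /smooth (cm_trunc_cm _ _).1 mul1r /divsum big_mkcond big_nat1 /= hh.1 ln1 subr0 divr1 mul1r.
  rewrite ler_wpDr ?le_max ?lexx ?orbT // big_nat_cond sumr_ge0 // => m /andP[/andP[m0 _] _].
  by rewrite mulr_ge0 ?smooth_ge0 ?w_ge0 // ltnW.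
have [pk|pk] := boolP (prime k.+1); last first.
  rewrite /F /B prod_primeS sum_primeS (negbTE pk) mulr1 addr0.
  by apply: (le_trans (IH _ LN)); rewrite /E /smooth sum_cm_truncS_nprime // (negbTE pk).
have k0 : 0 < k.+1%:R :> R by rewrite ltr0n.
set t := (1 + h k.+1) / k.+1%:R; have t0 : 0 <= t := t_ge0 pk.
have lk0 : 0 <= lnN k.+1 := lnN_ge0 R _.
rewrite /F /B prod_primeS sum_primeS pk -/(F k) -/(B k) mulrCA -/t.
have LN' : L - lnN k.+1 <= lnN N.+1 by lra.
have IH1 := IH _ LN; have IH2 := IH _ LN'.
have step : E k L + t * E k (L - lnN k.+1) <= E k.+1 L.
  rewrite /E [leRHS](sum_cm_truncS _ (fun m => divsum h m / m%:R * Num.max 0 (L - lnN m)) _ pk).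
  rewrite mul1r lerD2l // mulr_sumr.
  (* Since [L <= ln (N + 1)], the shifted weight vanishes as soon as [k.+1 * m > N], so the cutoff
     at [N] removes nothing here. *)
  rewrite (big_cat_nat (n := (N %/ k.+1).+1)) ?ltnS ?leq_div //=.
  rewrite [X in _ + X]big_nat_cond [X in _ + X]big1 => [|m /andP[/andP[Nm mN] _]]; last first.
    have m0 : (0 < m)%N by apply: leq_ltn_trans Nm.
    have : lnN N.+1 <= lnN (k.+1 * m) by apply: ler_lnN; rewrite // mulnC -ltn_divLR.
    by rewrite lnN_mul // => LNm; rewrite max_l ?mulr0 //; lra.
  rewrite addr0 big_nat_cond [leRHS]big_nat_cond; apply: ler_sum => m /andP[/andP[m0 _] _].
  rewrite lnN_mul // opprD addrA natrM.
  set M := Num.max _ _; have M0 : 0 <= M by rewrite /M le_max lexx.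
  have m0' : 0 < m%:R :> R by rewrite ltr0n.
  have g0 : 0 <= divsum h m by apply: divsum_ge0.
  have g1 : 0 <= divsum h (k.+1 * m) by apply: divsum_ge0; rewrite ?muln_gt0.
  have [km|km] := boolP (k.+1 %| m)%N.
    rewrite /smooth (cm_trunc_eq0 _ pk (ltnSn k)) // mul0r mulr0.
    by rewrite mulr_ge0 ?cm_trunc_ge0 // !mulr_ge0 ?invr_ge0 ?mulr_ge0.
  rewrite divsum_mulp_notin ?(negbTE km) // cm_truncS_ndvd ?(negbTE km) ?andbF //.
  by rewrite le_eqVlt; apply/orP; left; apply/eqP; rewrite /t /smooth; field; rewrite !gt_eqF.
(* The two induction bounds add up to [F k * ((1 + t) (L - B k) - t ln k.+1)]; giving away
   [F k * t^2 ln k.+1] completes the factor [1 + t]. *)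
apply: le_trans step; have F0 := F_ge0 k; clearbody t.
have H2 := ler_wpM2l t0 IH2.
have : 0 <= F k * (t * (t * lnN k.+1)) by rewrite !mulr_ge0.
by move: IH1 H2; lra.
Qed.

End LogWeight.

(** The exponent [8] makes [B <= 4 ln Y] half of [ln Z], so removing the logarithmic weight costs a
    factor [2]. Of the [5], [4] pays for [1 + t >= exp (t - t^2)] with [t^2 <= 4 / (p (p - 1))], and
    [1] for the Mertens bound that supplies [ln Y]. *)
Lemma smooth_sum_ge h Y : completely_multiplicative h -> (forall p, prime p -> `|h p| <= 1) ->
  (1 < Y)%N ->
  expR (\sum_(1 <= p < Y.+1 | prime p) h p / p%:R - 5%:R) * lnN Y <=
  2%:R * \sum_(1 <= m < (Y ^ 8).+1) smooth Y m * (divsum h m / m%:R).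
Proof.
move=> hh hp Y1; set Z := (Y ^ 8)%N; have Y0 : (0 < Y)%N := ltnW Y1.
have Z0 : (0 < Z)%N by rewrite expn_gt0 Y0.
have lY0 : 0 < lnN Y by rewrite ln_gt0 // ltr1n.
have lZ : lnN Z = 8%:R * lnN Y by rewrite /Z natrX lnXn ?ltr0n // mulr_natl.
have := @smooth_log_sum_ge h Z hh hp Z0 Y (lnN Z) (ler_lnN _ Z0 (leqnSn Z)).
set F := (X in X * _); set B := (X in _ - X) => FBE.
have hb p : prime p -> 0 <= 1 + h p <= 2%:R.
  by move=> /hp; rewrite ler_norml => /andP[? ?]; apply/andP; split; lra.
have BY : B <= 4%:R * lnN Y.
  apply: (@le_trans _ _ (2%:R * (2%:R * lnN Y))); last by rewrite mulrA -natrM.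
  apply: (le_trans _ (ler_wpM2l _ (sum_prime_ln_div R Y0))) => //.
  rewrite mulr_sumr; apply: ler_sum => p /hb /andP[h0 h2].
  by rewrite ler_wpM2r // divr_ge0 ?lnN_ge0.
have FZ : F * lnN Z <= 2%:R * (lnN Z * \sum_(1 <= m < Z.+1) smooth Y m * (divsum h m / m%:R)).
  have F0 : 0 <= F.
    by apply: prodr_ge0 => p /hb /andP[h0 _]; rewrite addr_ge0 // divr_ge0.
  apply: (@le_trans _ _ (2%:R * (F * (lnN Z - B)))).
    by rewrite lZ [leRHS]mulrCA ler_wpM2l //; lra.
  rewrite ler_wpM2l //; apply: (le_trans FBE); rewrite mulr_sumr.
  rewrite big_nat_cond [leRHS]big_nat_cond; apply: ler_sum => m /andP[/andP[m0 mZ] _].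
  rewrite [leRHS]mulrCA ler_wpM2l ?smooth_ge0 // [leRHS]mulrC ler_wpM2l //.
    by rewrite divr_ge0 ?divsum_ge0.
  by rewrite ge_max lnN_ge0 gerBl lnN_ge0.
have {}FZ : F <= 2%:R * \sum_(1 <= m < Z.+1) smooth Y m * (divsum h m / m%:R).
  have lZ0 : 0 < lnN Z by rewrite lZ mulr_gt0.
  by rewrite -(ler_pM2l lZ0) mulrCA [lnN Z * F]mulrC.
apply: le_trans FZ; set S := \sum_(1 <= p < _ | _) _.
have le1 : lnN Y <= expR (\sum_(1 <= p < Y.+1 | prime p) p%:R^-1 + 1) := sum_prime_inv_ge R Y.
apply: (le_trans (ler_wpM2l (expR_ge0 _) le1)); rewrite -expRD.
apply: (@le_trans _ _ (expR (\sum_(1 <= p < Y.+1 | prime p)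
  ((1 + h p) / p%:R - 4%:R * (p%:R * (p%:R - 1))^-1)))).
  rewrite ler_expR sumrB -mulr_sumr.
  have -> : \sum_(1 <= p < Y.+1 | prime p) (1 + h p) / p%:R =
     \sum_(1 <= p < Y.+1 | prime p) p%:R^-1 + S.
    by rewrite /S -big_split; apply: eq_bigr => p _; rewrite /= mulrDl mul1r.
  have : \sum_(1 <= p < Y.+1 | prime p) (p%:R * (p%:R - 1))^-1 <= 1 :> R.
    case: (Y) Y0 => // Y' _; apply: (le_trans (sum_prime_inv_pronic R _)).
    by rewrite gerBl invr_ge0.
  by set u := \sum_(_ <= _ < _ | _) (_ * _)^-1; set v := \sum_(_ <= _ < _ | _) _^-1; lra.
rewrite expR_sum /F; apply: ler_prod => p pp; rewrite expR_ge0 /=.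
have p1 : 1 < p%:R :> R by rewrite ltr1n prime_gt1.
have p0 : 0 < p%:R :> R by rewrite ltr0n prime_gt0.
have /andP[h0 h2] := hb _ pp; set t := (1 + h p) / p%:R.
have t0 : 0 <= t by rewrite divr_ge0.
have t1 : 0 < 1 + t by rewrite ltr_wpDr.
have tp : t ^+ 2 <= 4%:R * (p%:R * (p%:R - 1))^-1.
  rewrite /t expr_div_n ler_pM ?sqr_ge0 ?invr_ge0 ?exprn_ge0 //; first by nra.
  rewrite lef_pV2 ?posrE ?mulr_gt0 ?subr_gt0 ?exprn_gt0 //; nra.
apply: (@le_trans _ _ (expR (t / (1 + t)))).
  rewrite ler_expR ler_pdivlMr //; nra.
have -> : t / (1 + t) = - (- (t / (1 + t))) by rewrite opprK.
rewrite expRN -[leRHS]invrK lef_pV2 ?posrE ?expR_gt0 ?invr_gt0 //.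
apply: le_trans (expR_ge1Dx _); rewrite le_eqVlt; apply/orP; left; apply/eqP.
by field; rewrite gt_eqF.
Qed.

(** For a prime [q > Y], [h q = 0] gives [divsum h (q * m) = divsum h m]. Weighting [n = q * m] by
    [ln q] costs at most [ln n] per [n], while Chebyshev's bound gives weight [>> N / m] to each
    [m <= Y ^ 8]: the logarithmic sum over smooth [m] becomes a plain sum up to [N]. *)
Lemma divsum_sum_ge : exists2 Y0 : nat, (1 < Y0)%N & forall h Y N,
  completely_multiplicative h -> (forall p, prime p -> `|h p| <= 1) ->
  (forall p, prime p -> (Y < p)%N -> h p = 0) ->
  (Y0 <= Y)%N -> (48 * Y ^ 10 <= N)%N ->
  expR (\sum_(1 <= p < Y.+1 | prime p) h p / p%:R - 5%:R) * lnN Y * N%:R <=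
  96%:R * lnN N * \sum_(1 <= n < N.+1) divsum h n.
Proof.
have [X0 che] := chebyshev R.
exists (X0 + 2)%N => [|h Y N hh hp hY Y0 YN]; first by rewrite addn2.
have Y1 : (1 < Y)%N by apply: leq_trans Y0; rewrite addn2.
have YY0 : (0 < Y)%N := ltnW Y1.
set Z := (Y ^ 8)%N; have Z0 : (0 < Z)%N by rewrite expn_gt0 YY0.
have ZYN : (48 * (Z * Y ^ 2) <= N)%N by rewrite /Z -expnD.
have N0 : (0 < N)%N by apply: leq_trans ZYN; rewrite muln_gt0 muln_gt0 Z0 expn_gt0 YY0.
pose L q := if (Y < q)%N then prime_ln R q else 0.
have L0 q : 0 <= L q by rewrite /L; case: ifP => // _; apply: prime_ln_ge0.
have H1 : \sum_(1 <= n < N.+1) divsum L n * divsum h n <= lnN N * \sum_(1 <= n < N.+1) divsum h n.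
  rewrite mulr_sumr big_nat_cond [leRHS]big_nat_cond; apply: ler_sum => n /andP[/andP[n0 nN] _].
  rewrite ler_wpM2r ?divsum_ge0 // (@le_trans _ _ (lnN n)) ?ler_lnN //.
  apply: le_trans (divsum_prime_ln R n0); apply: ler_sum => q _.
  by rewrite /L; case: ifP => // _; apply: prime_ln_ge0.
have H2 : \sum_(1 <= n < N.+1) divsum L n * divsum h n =
    \sum_(1 <= m < N.+1) divsum h m * \sum_(1 <= q < (N %/ m).+1) L q.
  rewrite sum_divsum -dirichlet_swap; apply: eq_big_nat => q /andP[q0 _].
  rewrite /L /prime_ln; case: ifP => [Yq|_]; last by rewrite !mul0r.
  case: ifP => [pq|_]; last by rewrite !mul0r.
  by congr (_ * _); apply: eq_big_nat => m /andP[m0 _]; rewrite divsum_mulp_eq0 // hY.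
(* Chebyshev's [1 / 12], less [1 / 48] for the primes up to [Y], halved by the integer part of
   [N / m], still exceeds [1 / 48]. *)
have H3 m : (0 < m)%N -> (m <= Z)%N -> N%:R / (48%:R * m%:R) <= \sum_(1 <= q < (N %/ m).+1) L q.
  move=> m0 mZ; have m0' : 0 < m%:R :> R by rewrite ltr0n.
  have YNm : (48 * Y ^ 2 <= N %/ m)%N.
    by rewrite leq_divRL //; apply: leq_trans ZYN; rewrite -mulnA leq_mul2l mulnC leq_mul2r mZ orbT.
  have Y2 : (Y < Y ^ 2)%N by rewrite -[X in (X < _)%N]expn1 ltn_exp2l.
  have XN : (X0 <= N %/ m)%N.
    by move: Y0 YNm Y2; rewrite addn2; move: (Y ^ 2)%N (N %/ m)%N; lia.
  have := che _ XN.
  have YNm' : (Y < (N %/ m).+1)%N by rewrite ltnS; move: YNm Y2; move: (Y ^ 2)%N; lia.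
  rewrite (big_cat_nat _ YNm') //= [\sum_(1 <= q < _.+1) L q](big_cat_nat _ YNm') //=.
  have -> : \sum_(Y.+1 <= q < (N %/ m).+1) L q = \sum_(Y.+1 <= q < (N %/ m).+1) prime_ln R q.
    by apply: eq_big_nat => q /andP[Yq _]; rewrite /L Yq.
  move=> che'; rewrite ler_wpDl ?sumr_ge0 //.
  have thY : \sum_(1 <= p < Y.+1) prime_ln R p <= (Y ^ 2)%:R.
    apply: (@le_trans _ _ (\sum_(1 <= p < Y.+1) Y%:R)); last first.
      by rewrite sumr_const_nat subn1 /= natrX expr2 mulr_natl.
    rewrite big_nat_cond [leRHS]big_nat_cond; apply: ler_sum => p /andP[/andP[p0 pY] _].
    rewrite /prime_ln; case: ifP => // _; apply: (@le_trans _ _ (p%:R)); last by rewrite ler_nat.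
    by rewrite ltW // ln_sublinear // ltr0n.
  have Nm : N%:R / m%:R <= 2%:R * (N %/ m)%:R :> R.
    rewrite ler_pdivrMr // -!natrM ler_nat.
    have : (0 < N %/ m)%N by move: YNm Y2; move: (Y ^ 2)%N; lia.
    by have := divn_eq N m; have := ltn_pmod N m0; nia.
  have YNm2 : 48%:R * (Y ^ 2)%:R <= (N %/ m)%:R :> R by rewrite -natrM ler_nat.
  have -> : N%:R / (48%:R * m%:R) = 48%:R^-1 * (N%:R / m%:R) :> R by field; rewrite gt_eqF.
  have := ler0n R (N %/ m)%N; lra.
have H4 : 48%:R^-1 * N%:R * \sum_(1 <= m < Z.+1) smooth Y m * (divsum h m / m%:R) <=
    \sum_(1 <= m < N.+1) divsum h m * \sum_(1 <= q < (N %/ m).+1) L q.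
  have ZN : (Z <= N)%N by apply: leq_trans ZYN; rewrite mulnCA leq_pmulr // muln_gt0 expn_gt0 YY0.
  rewrite [leRHS](big_cat_nat (n := Z.+1)) //= ler_wpDr //.
    rewrite big_nat_cond sumr_ge0 // => m /andP[/andP[Zm _] _].
    apply: mulr_ge0; last exact: sumr_ge0.
    by apply: divsum_ge0 => //; apply: leq_ltn_trans Zm.
  rewrite [leLHS]mulr_sumr; apply: ler_sum_nat => m /andP[m0 mZ].
  have m0' : 0 < m%:R :> R by rewrite ltr0n.
  have g0 : 0 <= divsum h m by apply: divsum_ge0.
  apply: le_trans (ler_wpM2l g0 (H3 _ m0 mZ)).
  have -> : 48%:R^-1 * N%:R * (smooth Y m * (divsum h m / m%:R)) =
    smooth Y m * (divsum h m * (N%:R / (48%:R * m%:R))) by field; rewrite gt_eqF.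
  by rewrite ler_piMl ?smooth_le1 // mulr_ge0 // divr_ge0 // mulr_ge0.
have := smooth_sum_ge hh hp Y1; rewrite -/Z.
set W := expR _ * _; set U := \sum_(1 <= m < Z.+1) _ => WU.
have : 48%:R^-1 * N%:R * U <= lnN N * \sum_(1 <= n < N.+1) divsum h n.
  by rewrite (le_trans H4) // -H2.
rewrite -[96%:R * _ * _]mulrA; set V := lnN N * _ => UV.
have := ler_wpM2r (ler0n R N) WU; lra.
Qed.

End DivisorSumLowerBound.

(** * From the mean value hypothesis to the logarithmic sum of [h] *)

Section LogarithmicSumLowerBound.
Variable R : realType.
Implicit Types (h s : nat -> R) (d k n p D N W Y : nat).
Local Notation lnN n := (ln (n%:R : R)).

(** For [n <= N / 2] the Cesaro weight [2 (N - n)] is at least [N]. One [Q] comes from the plain sum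
    of [h] and four from the sum against [rho]; below [D] only [|h| <= 1] is used, which produces
    [4 N D]. *)
Lemma log_sum_ge h D N (Q : R) :
  completely_multiplicative h -> (forall p, prime p -> `|h p| <= 1) ->
  (0 < N)%N -> (D <= N)%N -> 0 <= Q ->
  (forall d, (D <= d <= N)%N -> `|\sum_(1 <= n < d.+1) h n| <= Q * d%:R) ->
  N%:R * \sum_(1 <= n < (N./2).+1) divsum h n <=
  N%:R ^+ 2 * (\sum_(1 <= n < N.+1) h n / n%:R + 5%:R * Q) + 4%:R * N%:R * D%:R.
Proof.
move=> hh hp N0 DN Q0 hQ; have N0' : 0 < N%:R :> R by rewrite ltr0n.
have g0 n : (0 < n)%N -> 0 <= divsum h n by apply: divsum_ge0.
have HR : `|\sum_(1 <= d < N.+1) h d * rho R d N| <= 4%:R * N%:R * (D%:R + N%:R * Q).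
  apply: (le_trans (rho_sum_le (M := fun d => (if (d < D)%N then 1 else 0) + Q) N0 _)).
    move=> d /andP[d0 dN]; case: ltnP => dD; last by rewrite add0r hQ // dD ltnW.
    rewrite mulrDl mul1r ler_wpDr ?mulr_ge0 //; apply: (le_trans (ler_norm_sum _ _ _)).
    apply: (@le_trans _ _ (\sum_(1 <= n < d.+1) 1)); last by rewrite sumr_const_nat subn1.
    by apply: ler_sum_nat => n /andP[n0 _]; apply: cm_norm_le1.
  rewrite ler_wpM2l ?mulr_ge0 // big_split /= sumr_const_nat lerD //.
    rewrite (@le_trans _ _ (\sum_(0 <= d < D) 1)) //; last by rewrite sumr_const_nat subn0.
    rewrite -big_mkcond /= [leRHS]big_nat_cond -[leRHS]big_nat_cond.
    rewrite (@le_trans _ _ (\sum_(0 <= d < N) if (d < D)%N then 1 else 0)) //.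
      by rewrite big_mkcond [leRHS](big_cat_nat (n := 1%N)) //= lerDr sumr_ge0 // => d _; case: ifP.
    rewrite (big_cat_nat (n := D)) //= [X in _ + X]big_nat_cond [X in _ + X]big1.
      by rewrite addr0; apply: ler_sum => d _; case: ifP.
    by move=> d /andP[/andP[Dd _] _]; rewrite ltnNge Dd.
  by rewrite -[leLHS]mulr_natl ler_wpM2r // ler_nat leq_subr.
have HM := hQ N; rewrite DN leqnn in HM; have {}HM := HM isT.
have HG : N%:R * \sum_(1 <= n < (N./2).+1) divsum h n <=
    2%:R * \sum_(1 <= n < N.+1) divsum h n * (N%:R - n%:R).
  have N2 : (N./2 < N.+1)%N by rewrite ltnS -[leqRHS]odd_double_half -addnn addnA leq_addl.
  rewrite [in leRHS](big_cat_nat _ N2) //= mulrDr ler_wpDr //.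
    rewrite mulr_ge0 // big_nat_cond sumr_ge0 // => n /andP[/andP[Nn nN] _].
    by rewrite mulr_ge0 ?g0 ?(leq_ltn_trans _ Nn) // subr_ge0 ler_nat.
  rewrite !mulr_sumr; apply: ler_sum_nat => n /andP[n0 nN].
  rewrite mulrCA mulrC ler_wpM2l ?g0 //.
  have : n%:R * 2%:R <= N%:R :> R.
    by rewrite -natrM ler_nat; have := odd_double_half N; move: nN; lia.
  lra.
apply: (le_trans HG); rewrite cesaro_identity.
move: HR HM; rewrite !ler_norml => /andP[_ H1] /andP[H2 _].
have {}H2 := ler_wpM2l (ltW N0') H2.
set V := \sum_(1 <= d < N.+1) h d / d%:R in H1 H2 *; set T := \sum_(1 <= d < N.+1) _ * _ in H1 *.
set M := \sum_(1 <= d < N.+1) h d in H1 H2 *.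
have -> : N%:R ^+ 2 * (V + 5%:R * Q) + 4%:R * N%:R * D%:R =
   N%:R ^+ 2 * V - N%:R * (- (Q * N%:R)) + 4%:R * N%:R * (D%:R + N%:R * Q) by ring.
lra.
Qed.

Definition mean_value_bound (eps K : R) :=
  forall (x : R) h, 3%:R <= x -> completely_multiplicative h ->
     (forall n, (0 < n)%N -> `|h n| <= 1) ->
     (forall p, prime p -> x `^ eps < p%:R -> h p = 0) ->
     `|sum_upto x h| <=
       K * (x / ln (ln x)) * expR (prime_sum_upto x (fun p => h p / p%:R)).

(** For [d >= Y ^ j] with [j * eps >= 1] one has [d^eps >= Y], so vanishing above [Y] meets the
    support condition. The bound [Y >= 16] makes [ln ln (Y ^ j)] positive. *)
Lemma mean_value_nat (eps K : R) : mean_value_bound eps K -> 0 < K ->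
  forall j Y h d, 1 <= j%:R * eps -> completely_multiplicative h ->
  (forall p, prime p -> `|h p| <= 1) ->
  (forall p, prime p -> (Y < p)%N -> h p = 0) ->
  (0 < j)%N -> 0 < eps -> (16 <= Y)%N -> (Y ^ j <= d)%N ->
  `|\sum_(1 <= n < d.+1) h n| <=
  K * expR (\sum_(1 <= p < Y.+1 | prime p) h p / p%:R) / ln (lnN (Y ^ j)) * d%:R.
Proof.
move=> Hmean K0 j Y h d jeps hh hp hY j0 eps0 Y3 Yd.
have Y0 : (0 < Y)%N by apply: leq_trans Y3.
have YYj : (Y <= Y ^ j)%N by rewrite -{1}[Y]expn1 leq_pexp2l.
have Yd' := leq_trans YYj Yd.
have d3 : 3%:R <= d%:R :> R by rewrite ler_nat (leq_trans _ (leq_trans Y3 Yd')).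
have := Hmean d%:R h d3 hh (cm_norm_le1 hh hp).
have -> : sum_upto d%:R h = \sum_(1 <= n < d.+1) h n by rewrite /sum_upto natrK.
have -> : prime_sum_upto d%:R (fun p => h p / p%:R) =
    \sum_(1 <= p < Y.+1 | prime p) h p / p%:R.
  rewrite /prime_sum_upto natrK (big_cat_nat (n := Y.+1)) //= [X in _ + X]big_nat_cond.
  rewrite [X in _ + X]big1 ?addr0 // => p /andP[/andP[Yp _] pp].
  by rewrite hY // mul0r.
move=> H; apply: (le_trans (H _)) => [p pp dp|].
  apply: hY => //; rewrite -(ltr_nat R); apply: le_lt_trans dp.
  apply: (@le_trans _ _ ((Y ^ j)%:R `^ eps)); last first.
    by apply: ge0_ler_powR; rewrite ?nnegrE ?ler_nat // ltW.
  rewrite natrX -powR_mulrn // -powRrM -{1}[Y%:R]powRr1 // ler_powR // ler1n //.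
have lnYj : 1 < lnN (Y ^ j).
  apply: (@lt_le_trans _ _ (lnN 16)); last by apply: ler_lnN => //; apply: leq_trans YYj.
  have -> : 16%:R = 2%:R ^+ 4 :> R by rewrite -natrX.
  by rewrite lnXn // -[ltRHS]mulr_natl; have := half_le_ln2 R; lra.
have lnd : lnN (Y ^ j) <= lnN d by apply: ler_lnN; rewrite // expn_gt0 Y0.
set e := expR _; have -> : K * (d%:R / ln (lnN d)) * e = K * e / ln (lnN d) * d%:R by ring.
rewrite ler_wpM2r // ler_wpM2l ?mulr_ge0 ?expR_ge0 ?(ltW K0) //.
rewrite lef_pV2 ?posrE ?ln_gt0 ?(lt_le_trans lnYj) // ler_ln ?posrE //.
  by rewrite (lt_trans _ lnYj).
by rewrite (lt_trans _ (lt_le_trans lnYj lnd)).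
Qed.

Lemma smooth_log_sum_lower (eps K : R) : 0 < eps -> 0 < K -> mean_value_bound eps K ->
  exists k (c : R) W0, [/\ (0 < k)%N, 0 < c & forall W N s, (W0 <= W)%N ->
    (W ^ (16 * k) <= N < W.+1 ^ (16 * k))%N -> (forall p, prime p -> `|s p| <= 1) ->
    c * W%:R ^- 2 <= \sum_(1 <= n < N.+1) cm_trunc s (W ^ 16) n / n%:R].
Proof.
move=> eps0 K0 Hmean.
pose j := (Num.truncn (eps^-1)).+1.
have jeps : 1 <= j%:R * eps.
  by rewrite -ler_pdivrMr // mul1r ltW // truncnS_gt.
have [Y0 Y01 Hsum] := divsum_sum_ge R.
have [C [C0 Hinv]] := sum_prime_inv_le R.
(* The margin [Y ^ 12] over [Y ^ j] ensures both [48 * Y ^ 10 <= N./2] and [D / N <= W^(-3)]. *)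
pose k := (j + 12)%N.
have kR0 : 0 < k%:R :> R by rewrite ltr0n.
(* [576 k = 96 * 2 k * 3]: [96] from [divsum_sum_ge], [2 k] bounding [ln N./2 / ln Y], and [3] from
   [N <= 3 * N./2]. *)
have [c1 c10 c1E] : exists2 c1 : R, 0 < c1 & c1 * 576%:R * k%:R = expR (- 5%:R).
  exists (expR (- 5%:R) / (576%:R * k%:R)); last by field; rewrite gt_eqF.
  by apply: divr_gt0; [exact: expR_gt0|rewrite -natrM ltr0n].
have nat_ub (x : R) : exists n, x <= n%:R by exists (Num.truncn x).+1; apply/ltW/truncnS_gt.
(* [n1] makes [ln ln D] so large that [5 Q] takes at most half of [c1 exp S]; [n2] keeps the
   contribution of [d < D] below a quarter of [c1 exp (- C) W^(-2)]. *)
have [n1 n1P] := nat_ub (expR (expR (10%:R * K / c1))).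
have [n2 n2P] := nat_ub (16%:R * expR C / c1).
exists k, (c1 / 4%:R * expR (- C)), (Y0 + 2 + n1 + n2)%N.
split=> // [|W N s WW /andP[WN NW] sp].
  by apply: mulr_gt0; [apply: divr_gt0|apply: expR_gt0].
have [W2 WY0 Wn1 Wn2] : [/\ 2 <= W, Y0 <= W, n1 <= W & n2 <= W]%N.
  by move: WW; clear; split; lia.
have Wexp : expR (expR (10%:R * K / c1)) <= W%:R by rewrite (le_trans n1P) ?ler_nat.
have WC : 16%:R * expR C / c1 <= W%:R by rewrite (le_trans n2P) ?ler_nat.
clear WW.
have W1 : (0 < W)%N := ltnW W2.
have WR : 0 < W%:R :> R by rewrite ltr0n.
have [Y YE] : exists Y, Y = (W ^ 16)%N by exists (W ^ 16)%N.
have YW4 : (W ^ 4 <= Y)%N by rewrite YE leq_pexp2l.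
have Y16 : (16 <= Y)%N by apply: leq_trans YW4; rewrite (@leq_exp2r 2 _ 4).
have YW : (W <= Y)%N by apply: leq_trans YW4; rewrite -{1}[W]expn1 leq_pexp2l.
have lnY : lnN Y = 16%:R * lnN W by rewrite YE natrX lnXn // mulr_natl.
have lnY0 : 0 < lnN Y by rewrite ln_gt0 // ltr1n (leq_trans _ Y16).
move: WN NW; rewrite !expnM -YE => WN NW; clear YW4.
have Ypos : (0 < Y)%N by apply: leq_trans Y16.
pose h := cm_trunc s Y; have hh : completely_multiplicative h := cm_trunc_cm _ _.
have hp p : prime p -> `|h p| <= 1.
  by move=> pp; apply: cm_trunc_norm_le1 => //; apply: prime_gt0.
have hY p : prime p -> (Y < p)%N -> h p = 0.
  by move=> pp Yp; rewrite /h cm_trunc_prime // leqNgt Yp.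
have [D DE] : exists D, D = (Y ^ j)%N by exists (Y ^ j)%N.
have YD : (Y <= D)%N by rewrite DE -{1}[Y]expn1 leq_pexp2l.
have DN : (D * Y ^ 12 <= N)%N by rewrite DE -expnD.
have N0 : (0 < N)%N.
  by apply: leq_trans DN; rewrite muln_gt0 expn_gt0 Ypos (leq_trans Ypos YD).
have NR : 0 < N%:R :> R by rewrite ltr0n.
have DN1 : (D <= N)%N by apply: leq_trans DN; rewrite leq_pmulr // expn_gt0 Ypos.
set S := \sum_(1 <= p < Y.+1 | prime p) h p / p%:R.
have lnlnD : 10%:R * K / c1 <= ln (lnN D).
  have WD : W%:R <= D%:R :> R by rewrite ler_nat (leq_trans YW).
  have lD : expR (10%:R * K / c1) <= lnN D.
    rewrite -[leLHS]expRK ler_ln ?posrE ?expR_gt0 ?(le_trans Wexp) //.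
    by rewrite ltr0n (leq_trans Ypos).
  by rewrite -[leLHS]expRK ler_ln ?posrE ?expR_gt0 // (lt_le_trans (expR_gt0 _) lD).
have K10 : 0 < 10%:R * K / c1 by rewrite divr_gt0 // mulr_gt0.
have lnlnD0 : 0 < ln (lnN D) by apply: lt_le_trans lnlnD.
pose Q := K * expR S / ln (lnN D).
have Q0 : 0 <= Q by rewrite divr_ge0 ?mulr_ge0 ?expR_ge0 ?ltW.
have hQ d : (D <= d <= N)%N -> `|\sum_(1 <= n < d.+1) h n| <= Q * d%:R.
  move=> /andP[Dd _]; rewrite /Q DE.
  by apply: (mean_value_nat Hmean) => //; rewrite -DE.
have := log_sum_ge hh hp N0 DN1 Q0 hQ.
set A := \sum_(1 <= n < _) divsum h n; set V := \sum_(1 <= n < N.+1) _ => HA.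
have N2 : (48 * Y ^ 10 <= N./2)%N.
  rewrite geq_half_double; apply: leq_trans DN.
  have -> : (Y ^ 12 = Y ^ 10 * Y ^ 2)%N by rewrite -expnD.
  have : (16 ^ 2 <= Y ^ 2)%N by rewrite leq_exp2r.
  move=> Y2; apply: (@leq_trans (1 * (Y ^ 10 * Y ^ 2))); last first.
    by rewrite leq_mul2r (leq_trans Ypos YD) orbT.
  by move: Y2; move: (Y ^ 10)%N (Y ^ 2)%N => a b; clear; nia.
have N20 : (0 < N./2)%N by apply: leq_trans N2; rewrite muln_gt0 expn_gt0 Ypos.
have HS := Hsum h Y N./2 hh hp hY (leq_trans WY0 YW) N2.
rewrite -/S -/A in HS.
have lnN2 : lnN N./2 <= 2%:R * k%:R * lnN Y.
  apply: (@le_trans _ _ (lnN (((W ^ 2) ^ 16) ^ k))).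
    apply: ler_lnN => //; apply: (@leq_trans N).
      by rewrite -[leqRHS]odd_double_half -addnn addnA leq_addl.
    apply: (leq_trans (ltnW NW)); rewrite !leq_exp2r //.
    by rewrite -mulnn; move: W2; clear; nia.
  have -> : ((W ^ 2) ^ 16 = Y ^ 2)%N by rewrite YE -!expnM mulnC.
  by rewrite -expnM natrX lnXn ?ltr0n // -[leLHS]mulr_natl natrM.
have HA1 : c1 * expR S * N%:R <= A.
  have N3 : N%:R <= 3%:R * (N./2)%:R :> R.
    by rewrite -natrM ler_nat; have := odd_double_half N; move: N20; clear; lia.
  have A0 : 0 <= A.
    by rewrite /A big_nat_cond sumr_ge0 // => n /andP[/andP[n0 _] _]; apply: divsum_ge0.
  have H1 : expR (S - 5%:R) * (N./2)%:R <= 192%:R * k%:R * A.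
    rewrite -(ler_pM2r lnY0) mulrAC; apply: (le_trans HS).
    have -> : 192%:R * k%:R * A * lnN Y = 96%:R * (2%:R * k%:R * lnN Y) * A by ring.
    by rewrite ler_wpM2r // ler_wpM2l.
  rewrite expRD -c1E in H1.
  have k576 : 0 < 192%:R * k%:R :> R by rewrite mulr_gt0.
  rewrite -(ler_pM2l k576); apply: le_trans H1.
  have -> : 192%:R * k%:R * (c1 * expR S * N%:R) = 192%:R * k%:R * (c1 * expR S) * N%:R by ring.
  have -> : expR S * (c1 * 576%:R * k%:R) * (N./2)%:R =
    192%:R * k%:R * (c1 * expR S) * (3%:R * (N./2)%:R) by ring.
  rewrite ler_wpM2l //; apply: mulr_ge0; first exact: ltW.
  by rewrite mulr_ge0 ?expR_ge0 // ltW.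
have HV : c1 * expR S <= V + 5%:R * Q + 4%:R * (W%:R ^+ 3)^-1.
  have DW : D%:R <= N%:R * (W%:R ^+ 3)^-1 :> R.
    rewrite ler_pdivlMr ?exprn_gt0 // -natrX -natrM ler_nat; apply: leq_trans DN.
    rewrite leq_mul2l; apply/orP; right; apply: (@leq_trans (Y ^ 3)); first by rewrite leq_exp2r.
    by rewrite leq_pexp2l.
  have NN : 0 < N%:R ^+ 2 :> R by rewrite exprn_gt0.
  rewrite -(ler_pM2l NN); have H1 := ler_wpM2l (ltW NR) HA1.
  have H2 : 4%:R * N%:R * D%:R <= 4%:R * N%:R * (N%:R * (W%:R ^+ 3)^-1) :> R.
    by rewrite ler_wpM2l // mulr_ge0.
  have -> : N%:R ^+ 2 * (c1 * expR S) = N%:R * (c1 * expR S * N%:R) by ring.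
  apply: (le_trans H1); apply: (le_trans HA).
  have -> : N%:R ^+ 2 * (V + 5%:R * Q + 4%:R * (W%:R ^+ 3)^-1) =
    N%:R ^+ 2 * (V + 5%:R * Q) + 4%:R * N%:R * (N%:R * (W%:R ^+ 3)^-1) by ring.
  by rewrite lerD2l.
have HQ : 5%:R * Q <= c1 / 2%:R * expR S.
  rewrite /Q mulrA ler_pdivrMr //.
  have -> : 5%:R * (K * expR S) = c1 / 2%:R * expR S * (10%:R * K / c1) by field; rewrite gt_eqF.
  by rewrite ler_wpM2l // mulr_ge0 ?expR_ge0 // divr_ge0 // ltW.
have HE : expR (- C) * W%:R ^- 2 <= expR S.
  have -> : W%:R ^- 2 = expR (- (2%:R * lnN W)) :> R.
    by rewrite expRN mulr_natl -lnXn // lnK // posrE exprn_gt0.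
  rewrite -expRD ler_expR; have := Hinv _ Ypos; rewrite lnY => HC.
  have : - S <= \sum_(1 <= p < Y.+1 | prime p) p%:R^-1.
    rewrite /S -sumrN; apply: ler_sum => p pp; rewrite -mulNr ler_piMl ?invr_ge0 //.
    by have := hp _ pp; rewrite ler_norml => /andP[]; lra.
  move: HC; set u := \sum_(_ <= _ < _ | _) _; lra.
have HW : 4%:R * (W%:R ^+ 3)^-1 <= c1 / 4%:R * (expR (- C) * W%:R ^- 2).
  rewrite expRN; have eC := expR_gt0 C.
  rewrite -subr_ge0; have -> : c1 / 4%:R * ((expR C)^-1 * W%:R ^- 2) - 4%:R * (W%:R ^+ 3)^-1 =
    (c1 / (4%:R * expR C * W%:R ^+ 3)) * (W%:R - 16%:R * expR C / c1).
    by field; rewrite !gt_eqF.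
  by rewrite mulr_ge0 ?subr_ge0 // divr_ge0 ?(ltW c10) // !mulr_ge0 ?exprn_ge0 ?(ltW eC).
have HE' := ler_wpM2l (ltW c10) HE.
rewrite -mulrA; move: (expR (- C) * _) HE' HW => u HE' HW; lra.
Qed.
End LogarithmicSumLowerBound.

(** * Exponential moments over sign patterns *)

Section SignAverage.
Variable R : realType.
Variables (A : {fset nat}) (N : nat).
Implicit Types (sg : {ffun A -> bool}) (i : A) (k n p Y : nat).

(** Off [A] the value defaults to [1]; in the application [A] is the set of all primes up to [N]. *)
Definition sign_of sg p : R := if insub p is Some i then (-1) ^+ (sg i) else 1.

Definition flip i sg : {ffun A -> bool} := [ffun j => (j == i) (+) sg j].

Lemma flipK i : involutive (flip i).
Proof. by move=> sg; apply/ffunP => j; rewrite !ffunE addbA addbb. Qed.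

Lemma norm_sign_of sg p : `|sign_of sg p| <= 1.
Proof.
by rewrite /sign_of; case: insubP => [i _ _|_]; rewrite ?normr1 // normrX normrN1 expr1n.
Qed.

Lemma sign_of_flip i sg p : sign_of (flip i sg) p = if p == val i then - sign_of sg p else sign_of sg p.
Proof.
rewrite /sign_of; case: insubP => [j _ <-|pA].
  by rewrite ffunE (inj_eq val_inj); case: eqP => // _; rewrite signr_addb mulN1r.
by case: eqP => // pE; move: pA; rewrite pE fsvalP.
Qed.

Definition signed_sum k sg : R := \sum_(1 <= n < N.+1) cm_trunc (sign_of sg) k n * n%:R^-1.

Let H : R := \sum_(1 <= n < N.+1) n%:R^-1.

Lemma norm_cm_sum_le (s : nat -> R) k M : (M <= N)%N -> (forall p, prime p -> `|s p| <= 1) ->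
  `|\sum_(1 <= n < M.+1) cm_trunc s k n * n%:R^-1| <= H.
Proof.
move=> MN hs; apply: (le_trans (ler_norm_sum _ _ _)).
rewrite /H (big_cat_nat (n := M.+1) (p := N.+1)) //= ler_wpDr ?sumr_ge0 //.
apply: ler_sum_nat => n /andP[n0 _]; rewrite normrM (ger0_norm (_ : 0 <= n%:R^-1)) ?invr_ge0 //.
by rewrite ler_piMl ?invr_ge0 // cm_trunc_norm_le1.
Qed.

(** Hoeffding's lemma for a sign, with a cheap constant: [exp v <= 1 / (1 - v) <= 1 + v + 2 v^2] for
    [|v| <= 1/2], and the linear terms cancel. *)
Lemma expR_sym_le (u : R) : `|u| <= 2%:R^-1 -> expR u + expR (- u) <= 2%:R * expR (2%:R * u ^+ 2).
Proof.
have E (v : R) : `|v| <= 2%:R^-1 -> expR v <= 1 + v + 2%:R * v ^+ 2.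
  rewrite ler_norml => /andP[v1 v2]; have v0 : 0 < 1 - v by lra.
  have := expR_ge1Dx (- v); rewrite expRN => H1.
  have : expR v <= (1 - v)^-1.
    by rewrite -[leLHS]invrK lef_pV2 ?posrE ?invr_gt0 ?expR_gt0.
  move=> /le_trans; apply.
  rewrite -[leLHS]mul1r ler_pdivrMr //; have := sqr_ge0 v; nra.
move=> hu; have := E _ hu; have := E (- u); rewrite normrN => /(_ hu).
have := expR_ge1Dx (2%:R * u ^+ 2); rewrite sqrrN; lra.
Qed.

(* One step of the Azuma-Hoeffding martingale argument: revealing the sign at
   the prime [k.+1] last, the increment is linear in it up to [H / k.+1 ^ 2]. *)
Lemma sum_expR_signed_sumS k (lam : R) :
  0 <= lam -> 2%:R * lam * H <= k.+1%:R -> (0 < k)%N -> (prime k.+1 -> k.+1 \in A) ->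
  \sum_sg expR (- (lam * signed_sum k.+1 sg)) <=
  expR ((2%:R * lam ^+ 2 * H ^+ 2 + lam * H) * (k%:R^-1 - k.+1%:R^-1)) *
  \sum_sg expR (- (lam * signed_sum k sg)).
Proof.
move=> lam0 lamH k0 kA.
have H0 : 0 <= H by apply: sumr_ge0 => n _; rewrite invr_ge0.
have kR : 0 < k%:R :> R by rewrite ltr0n.
have k1R : 0 < k.+1%:R :> R by rewrite ltr0n.
have G0 : 0 <= 2%:R * lam ^+ 2 * H ^+ 2 + lam * H.
  by rewrite addr_ge0 ?mulr_ge0 ?exprn_ge0.
(* This form lets the factors telescope when the step is iterated. *)
have kk : k.+1%:R^-1 ^+ 2 <= k%:R^-1 - k.+1%:R^-1 :> R.
  rewrite -[k.+1%:R]natr1 -subr_ge0.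
  have -> : k%:R^-1 - (k%:R + 1)^-1 - (k%:R + 1)^-1 ^+ 2 =
     k%:R^-1 * (k%:R + 1)^-1 ^+ 2 :> R.
    by field; rewrite !gt_eqF // addr_gt0.
  by rewrite mulr_ge0 ?invr_ge0 ?exprn_ge0 // invr_ge0 addr_ge0.
have [pk|pk] := boolP (prime k.+1); last first.
  rewrite (eq_bigr (fun sg => expR (- (lam * signed_sum k sg)))); last first.
    by move=> sg _; rewrite /signed_sum sum_cm_truncS_nprime // (negbTE pk).
  rewrite ler_peMl; [by []|by apply: sumr_ge0 => sg _; apply: expR_ge0|].
  by rewrite -[leLHS]expR0 ler_expR mulr_ge0 // (le_trans _ kk) // exprn_ge0 // invr_ge0.
set p := k.+1 in pk kA kk lamH k1R *; pose i : A := [` kA pk]%fset.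
pose a sg := \sum_(1 <= m < (N %/ p).+1) cm_trunc (sign_of sg) k m * m%:R^-1.
have aH sg : `|a sg| <= H.
  by apply: norm_cm_sum_le => // [|q _]; [exact: leq_div|exact: norm_sign_of].
have cm_flip sg n : (0 < n)%N ->
    cm_trunc (sign_of (flip i sg)) k n = cm_trunc (sign_of sg) k n.
  move=> n0; apply: eq_cm => // [||q qq _]; try exact: cm_trunc_cm.
  rewrite !cm_trunc_prime // sign_of_flip; case: ifP => // qk.
  by rewrite ltn_eqF // ltnS.
have a_flip sg : a (flip i sg) = a sg.
  by apply: eq_big_nat => m /andP[m0 _]; rewrite cm_flip.
have V_flip sg : signed_sum k (flip i sg) = signed_sum k sg.
  by apply: eq_big_nat => m /andP[m0 _]; rewrite cm_flip.
(* Expanding twice at [p] gives a linear term whose coefficient [a] involves only smaller primes,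
   and a second-order term of size at most [H / p^2], treated as a loss. *)
have V_step sg : signed_sum k sg + sign_of sg p * a sg / p%:R - H / p%:R ^+ 2 <= signed_sum p sg.
  rewrite /signed_sum sum_cm_truncS // -/p -addrA lerD2l.
  have -> : \sum_(1 <= m < (N %/ p).+1) cm_trunc (sign_of sg) p m * (p * m)%:R^-1 =
    p%:R^-1 * \sum_(1 <= m < (N %/ p).+1) cm_trunc (sign_of sg) p m * m%:R^-1.
    by rewrite mulr_sumr; apply: eq_bigr => m _; rewrite natrM invfM mulrCA.
  rewrite sum_cm_truncS // -/p -/(a sg).
  set b := \sum_(_ <= m < _) _.
  have -> : b = p%:R^-1 * \sum_(1 <= m < (N %/ p %/ p).+1) cm_trunc (sign_of sg) p m * m%:R^-1.
    by rewrite mulr_sumr; apply: eq_bigr => m _; rewrite natrM invfM mulrCA.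
  set c := \sum_(_ <= m < _) _; have cH : `|c| <= H.
    apply: norm_cm_sum_le => // [|q _]; last exact: norm_sign_of.
    by rewrite (leq_trans (leq_div _ _)) // leq_div.
  have ss : `|sign_of sg p * sign_of sg p| <= 1.
    by rewrite normrM mulr_ile1 ?norm_sign_of.
  have : `|sign_of sg p * sign_of sg p * c| <= H.
    by rewrite normrM -[H]mul1r ler_pM.
  rewrite ler_norml => /andP[h1 _].
  have := ler_wpM2r (_ : 0 <= p%:R^-1 ^+ 2) h1; rewrite exprn_ge0 ?invr_ge0 // => /(_ isT).
  rewrite mulrDr mulrDr exprVn; set t := p%:R^-1.
  have -> : sign_of sg p * (t * a sg) = sign_of sg p * a sg * t by ring.
  have -> : sign_of sg p * (t * (sign_of sg p * (t * c))) =
    sign_of sg p * sign_of sg p * c * (p%:R ^+ 2)^-1 by rewrite -exprVn -/t; ring.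
  by rewrite mulNr lerD2l.
pose u sg := lam * a sg / p%:R.
have uh sg : `|u sg| <= 2%:R^-1.
  rewrite /u !normrM (ger0_norm lam0) (ger0_norm (_ : 0 <= p%:R^-1)) ?invr_ge0 // ler_pdivrMr //.
  have := ler_wpM2l lam0 (aH sg); lra.
have u_flip sg : u (flip i sg) = u sg by rewrite /u a_flip.
pose Ev sg := expR (- (lam * signed_sum k sg)).
have E1 : \sum_sg expR (- (lam * signed_sum p sg)) <=
    expR (lam * H / p%:R ^+ 2) * \sum_sg Ev sg * expR (- (sign_of sg p * u sg)).
  rewrite mulr_sumr; apply: ler_sum => sg _; rewrite -!expRD ler_expR.
  have := ler_wpM2l lam0 (V_step sg); rewrite /u.
  have -> : lam * (signed_sum k sg + sign_of sg p * a sg / p%:R - H / p%:R ^+ 2) =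
    lam * signed_sum k sg + sign_of sg p * (lam * a sg / p%:R) - lam * H / p%:R ^+ 2 by ring.
  lra.
(* Reindexing by the involution [flip i] plays the part of averaging over the sign at [p]. *)
have E2 : \sum_sg Ev sg * expR (- (sign_of sg p * u sg)) =
    \sum_sg Ev sg * expR (sign_of sg p * u sg).
  rewrite (reindex_inj (inv_inj (flipK i))) /=; apply: eq_bigr => sg _.
  by rewrite /Ev V_flip u_flip sign_of_flip eqxx mulNr opprK.
have E3 : \sum_sg Ev sg * expR (- (sign_of sg p * u sg)) <=
    expR (2%:R * lam ^+ 2 * H ^+ 2 * p%:R^-1 ^+ 2) * \sum_sg Ev sg.
  set X := \sum_sg _; have : 2%:R * X =
      \sum_sg Ev sg * (expR (sign_of sg p * u sg) + expR (- (sign_of sg p * u sg))).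
    rewrite mulr_natl mulr2n {1}/X E2 -big_split /=; apply: eq_bigr => sg _.
    by rewrite mulrDr.
  move=> E4; rewrite -(ler_pM2l (_ : 0 < 2%:R)) // E4 mulrA mulr_sumr.
  apply: ler_sum => sg _; rewrite mulrC ler_wpM2r ?expR_ge0 //.
  have hs : `|sign_of sg p * u sg| <= 2%:R^-1.
    by rewrite normrM (le_trans _ (uh sg)) // ler_piMl ?norm_sign_of.
  apply: (le_trans (expR_sym_le hs)); rewrite ler_wpM2l // ler_expR.
  have sq (x y : R) : `|x| <= y -> x ^+ 2 <= y ^+ 2.
    move=> xy; rewrite -[x ^+ 2]real_normK ?num_real // lerXn2r ?nnegrE //.
    exact: le_trans xy.
  rewrite -!mulrA ler_wpM2l // exprMn; apply: (@le_trans _ _ (u sg ^+ 2)).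
    by rewrite ler_piMl ?sqr_ge0 // -[leRHS](expr1n _ 2) sq // norm_sign_of.
  have -> : lam * (lam * (H * (H * p%:R^-1 ^+ 2))) = lam ^+ 2 * H ^+ 2 / p%:R ^+ 2 :> R.
    by rewrite exprVn; ring.
  rewrite /u expr_div_n exprMn ler_wpM2r ?invr_ge0 ?exprn_ge0 // ler_wpM2l ?sqr_ge0 //.
  exact: sq.
apply: (le_trans E1); apply: (le_trans (ler_wpM2l (expR_ge0 _) E3)); rewrite mulrA -expRD.
apply: ler_wpM2r; first by apply: sumr_ge0 => sg _; apply: expR_ge0.
rewrite ler_expR; apply: (le_trans _ (ler_wpM2l G0 kk)); rewrite exprVn.
by rewrite le_eqVlt; apply/orP; left; apply/eqP; ring.
Qed.

(** The one-prime steps from [Y] to [N] multiply to at most [exp (G / Y)]. As [tau] is a lower bound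
    for every sign pattern, the starting sum is estimated term by term. *)
Lemma sum_expR_signed_sum_le Y (lam tau : R) :
  0 <= lam -> (0 < Y)%N -> (Y <= N)%N -> 2%:R * lam * H <= Y%:R ->
  (forall p, prime p -> (p <= N)%N -> p \in A) ->
  (forall sg, tau <= signed_sum Y sg) ->
  \sum_sg expR (- (lam * signed_sum N sg)) <=
  #|{ffun A -> bool}|%:R * expR ((2%:R * lam ^+ 2 * H ^+ 2 + lam * H) / Y%:R - lam * tau).
Proof.
move=> lam0 Y0 YN lamH NA hY; set G := 2%:R * _ * _ + _.
have H0 : 0 <= H by apply: sumr_ge0 => n _; rewrite invr_ge0.
have G0 : 0 <= G by rewrite addr_ge0 ?mulr_ge0 ?exprn_ge0.
have base : \sum_sg expR (- (lam * signed_sum Y sg)) <= #|{ffun A -> bool}|%:R * expR (- (lam * tau)).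
  rewrite mulr_natl -sumr_const; apply: ler_sum => sg _.
  by rewrite ler_expR lerN2 ler_wpM2l.
have ind d : (Y + d <= N)%N -> \sum_sg expR (- (lam * signed_sum (Y + d) sg)) <=
    expR (G * (Y%:R^-1 - (Y + d)%:R^-1)) * \sum_sg expR (- (lam * signed_sum Y sg)).
  elim: d => [|d IH] dN; first by rewrite addn0 subrr mulr0 expR0 mul1r.
  rewrite addnS; apply: (le_trans (@sum_expR_signed_sumS (Y + d) lam lam0 _ _ _)).
  - by apply: (le_trans lamH); rewrite ler_nat -addnS leq_addr.
  - by rewrite addn_gt0 Y0.
  - by move=> pp; apply: NA; rewrite // -addnS.
  rewrite -/G; apply: (le_trans (ler_wpM2l (expR_ge0 _) (IH _))); first by rewrite ltnW // -addnS.
  rewrite mulrA -expRD -mulrDr [X in G * X](_ : _ = Y%:R^-1 - (Y + d).+1%:R^-1) //.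
  by ring.
have := ind (N - Y)%N; rewrite subnKC // => /(_ (leqnn N)) /le_trans; apply.
apply: (le_trans (ler_wpM2l (expR_ge0 _) base)).
rewrite mulrCA ler_wpM2l // -expRD ler_expR lerD2r ler_wpM2l // gerBl invr_ge0 //.
Qed.

End SignAverage.

(** * Reduction of the probability to a count of sign patterns *)

Section Probability.
Context (d : measure_display) (T : measurableType d) (R : realType) (P : probability T R).
Variable f : nat -> {RV P >-> R}.

Lemma measurable_sum_neg N : measurable [set w | (\sum_(1 <= n < N.+1) f n w / n%:R < 0)%R].
Proof.
have mS : measurable_fun setT (fun w => \sum_(1 <= n < N.+1) f n w / n%:R).
  apply: measurable_sum => n; apply: measurable_realfun.measurable_funM; last exact: measurable_cst.
  by apply: measurable_funPT.
have := mS measurableT _ (measurable_itv `]-oo, 0%R[%R); rewrite setTI.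
by congr measurable; apply/seteqP; split=> w; rewrite /= in_itv.
Qed.

Lemma measure_bigsetU_le (I : Type) (s : seq I) (Q : pred I) (F : I -> set T) :
  (forall i, Q i -> measurable (F i)) ->
  (P (\big[setU/set0]_(i <- s | Q i) F i) <= \sum_(i <- s | Q i) P (F i))%E.
Proof.
move=> mF; elim: s => [|i s IH]; first by rewrite !big_nil measure0.
rewrite !big_cons; case: ifP => // Qi; apply: le_trans (leeD2l _ IH).
by apply: measureU2; [exact: mF|exact: bigsetU_measurable].
Qed.

Hypothesis hf : random_sign_cm f.
Variable A : {fset nat}.
Hypothesis A_prime : forall p, p \in A -> prime p.

Definition cylinder (sg : {ffun A -> bool}) : set T :=
  \bigcap_(p in [set` A]) (f p @^-1` [set sign_of R sg p]).

Lemma measurable_preimage1 p (y : R) : measurable (f p @^-1` [set y]).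
Proof. by apply: measurable_funPTI. Qed.

Lemma measurable_cylinder sg : measurable (cylinder sg).
Proof.
by apply: fin_bigcap_measurable => // p _; apply: measurable_preimage1.
Qed.

Lemma probability_cylinder sg : P (cylinder sg) = ((2%:R^-1 : R) ^+ #|` A|)%:E.
Proof.
rewrite /cylinder (rscm_indep hf) => [|p /= /A_prime //|p _]; last exact: measurable_set1.
rewrite big_seq_cond (eq_bigr (fun=> (2%:R^-1 : R)%:E)) => [|p]; last first.
  rewrite andbT => pA; rewrite /sign_of insubT /=; case: (sg _).
    by rewrite expr1; exact: (rscm_neg hf (A_prime pA)).
  by rewrite expr0; exact: (rscm_pos hf (A_prime pA)).
rewrite -big_seq_cond; elim: (enum_fset A) => [|p s IH]; first by rewrite big_nil.
by rewrite big_cons IH /= exprS EFinM.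
Qed.

(** The values [1] and [-1] have total probability [1], but other values may still occur on a null
    set, which has to be removed. *)
Lemma probability_not_sign p : prime p -> P (~` (f p @^-1` [set 1] `|` f p @^-1` [set -1])) = 0%E.
Proof.
move=> pp; rewrite probability_setC; last by apply: measurableU; apply: measurable_preimage1.
suff -> : P (f p @^-1` [set 1] `|` f p @^-1` [set -1]) = 1%E by rewrite subee.
rewrite (_ : 1 = ((2%:R^-1)%:E + (2%:R^-1)%:E))%E; last by rewrite -EFinD; congr (_%:E); field.
rewrite measureU; [|exact: measurable_preimage1|exact: measurable_preimage1|].
  by apply: (congr2 adde); [exact: (rscm_pos hf)|exact: (rscm_neg hf)].
apply/seteqP; split=> w //= -[-> /eqP]; rewrite -subr_eq0 opprK.
by rewrite -(natrD _ 1 1) pnatr_eq0.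
Qed.

(** Off the null set [Z], an outcome lies in the cylinder of its own sign pattern, which determines
    the sum since [A] contains every prime up to [N]. All cylinders are equally likely, so bad
    patterns are counted. *)
Lemma probability_sum_neg_le N : (forall p, prime p -> (p <= N)%N -> p \in A) ->
  (P [set w | (\sum_(1 <= n < N.+1) f n w / n%:R < 0)%R] <=
   (#|[pred sg : {ffun A -> bool} | signed_sum R N N sg < 0%R]|%:R * 2%:R^-1 ^+ #|` A|)%:E)%E.
Proof.
move=> NA; pose bad (sg : {ffun A -> bool}) := signed_sum R N N sg < 0.
pose Z := \big[setU/set0]_(p <- A | p \in A) ~` (f p @^-1` [set 1] `|` f p @^-1` [set -1]).
pose B := \big[setU/set0]_(sg : {ffun A -> bool} | bad sg) cylinder sg.
have mE := measurable_sum_neg N.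
have mZ : measurable Z.
  apply: bigsetU_measurable => p _; apply: measurableC.
  by apply: measurableU; apply: measurable_preimage1.
have mB : measurable B by apply: bigsetU_measurable => sg _; apply: measurable_cylinder.
have sub : [set w | (\sum_(1 <= n < N.+1) f n w / n%:R < 0)%R] `<=` Z `|` B.
  move=> w /= wneg; have [wZ|wZ] := pselect (Z w); [by left|right].
  have fw p : p \in A -> f p w = 1 \/ f p w = -1.
    move=> pA; apply: contrapT => H; apply: wZ; rewrite /Z.
    rewrite -bigcup_seq_cond /=; exists p => //=. by rewrite pA.
  pose sg : {ffun A -> bool} := [ffun i => f (val i) w == -1].
  have sgE p : p \in A -> sign_of R sg p = f p w.
    move=> pA; rewrite /sign_of insubT /= ffunE /=.
    case: (fw _ pA) => ->; rewrite ?eqxx ?expr1 //.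
    by rewrite -subr_eq0 opprK -(natrD _ 1 1) pnatr_eq0.
  have bad_sg : bad sg.
    rewrite /bad /signed_sum; apply: le_lt_trans wneg; rewrite le_eqVlt; apply/orP; left; apply/eqP.
    apply: eq_big_nat => n /andP[n0 nN]; congr (_ * _).
    apply: (@eq_cm R _ (fun n => f n w)) => // [||p pp pn]; [exact: cm_trunc_cm|exact: (rscm_mult hf)|].
    have pN : (p <= N)%N by rewrite (leq_trans (dvdn_leq n0 pn)).
    by rewrite cm_trunc_prime // pN sgE ?NA.
  rewrite /B -bigcup_seq_cond /=; exists sg; first by rewrite /= mem_index_enum.
  by move=> p /= pA; rewrite /= sgE.
have PZ : P Z = 0%E.
  apply/eqP; rewrite eq_le measure_ge0 andbT /Z.
  apply: le_trans (measure_bigsetU_le _ _) _ => [p _|].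
    by apply: measurableC; apply: measurableU; apply: measurable_preimage1.
  by rewrite big1 // => p pA; apply: probability_not_sign; apply: A_prime.
have PB : (P B <= (#|[pred sg | bad sg]|%:R * 2%:R^-1 ^+ #|` A|)%:E)%E.
  apply: le_trans (measure_bigsetU_le _ _) _ => [sg _|]; first exact: measurable_cylinder.
  rewrite (eq_bigr (fun=> ((2%:R^-1 : R) ^+ #|` A|)%:E)) => [|sg _]; last exact: probability_cylinder.
  by rewrite sumEFin lee_fin sumr_const mulr_natl.
apply: le_trans (le_measure P _ _ sub) _; rewrite ?inE //; first exact: measurableU.
have PZ0 : (P Z <= 0)%E by rewrite PZ.
apply: le_trans (measureU2 P mZ mB) _.
by apply: le_trans (leeD PZ0 PB) _; rewrite add0e.
Qed.
End Probability.

(** * Choice of parameters and conclusion *)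

Section Tail.
Variable R : realType.

(** With exponential parameter [W^8], the exponent is [2 H^2 + H / W^8 - c W^6]. Since
    [H <= 1 + ln N <= 17 k W], the gain [c W^6] dominates. *)
Lemma prob_negative_le_expR (k : nat) (c : R) W0 : (0 < k)%N -> 0 < c ->
  (forall W N (s : nat -> R), (W0 <= W)%N ->
    (W ^ (16 * k) <= N < W.+1 ^ (16 * k))%N -> (forall p, prime p -> `|s p| <= 1) ->
    c * W%:R ^- 2 <= \sum_(1 <= n < N.+1) cm_trunc s (W ^ 16) n / n%:R) ->
  exists W1, forall (d : measure_display) (T : measurableType d) (P : probability T R)
    (f : nat -> {RV P >-> R}), random_sign_cm f -> forall W (x : R), (W1 <= W)%N -> 0 <= x ->
    (W ^ (16 * k) <= Num.truncn x < W.+1 ^ (16 * k))%N ->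
    (prob_negative f x <= (expR (- W.+1%:R))%:E)%E.
Proof.
move=> k0 c0 low.
have nat_ub (y : R) : exists n, y <= n%:R by exists (Num.truncn y).+1; apply/ltW/truncnS_gt.
(* [600] exceeds [2 * 17^2 + 17 + 1 + 1], which covers [2 H^2], [H / W^8] and [W + 1]; [34 k <= W]
   secures the smallness condition [2 W^8 H <= Y]. *)
have [n1 n1P] := nat_ub (600%:R * k%:R ^+ 2 / c).
have [n2 n2P] := nat_ub (34%:R * k%:R : R).
exists (W0 + n1 + n2 + 1)%N => d T P f hf W x WW x0; set N := Num.truncn x => /andP[WN NW].
have [W0W Wn1 Wn2 Wpos] : [/\ W0 <= W, n1 <= W, n2 <= W & 0 < W]%N.
  by move: WW; clear; split; lia.
have k1 : 1 <= k%:R :> R by rewrite ler1n.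
have W1 : 1 <= W%:R :> R by rewrite ler1n.
have WR : 0 < W%:R :> R by rewrite ltr0n.
have hc : 600%:R * k%:R ^+ 2 <= c * W%:R.
  by rewrite [leRHS]mulrC -ler_pdivrMr // (le_trans n1P) // ler_nat.
have hk : 34%:R * k%:R <= W%:R :> R by rewrite (le_trans n2P) // ler_nat.
pose A := [fset p in [seq q <- iota 0 N.+1 | prime q]]%fset.
have inA p : (p \in A) = prime p && (p <= N)%N.
  by rewrite !inE mem_filter mem_iota add0n leq0n.
have A_prime p : p \in A -> prime p by rewrite inA => /andP[].
have NA p : prime p -> (p <= N)%N -> p \in A by move=> pp pN; rewrite inA pp.
rewrite /prob_negative /sum_upto -/N.
apply: (le_trans (probability_sum_neg_le hf A_prime NA)); rewrite lee_fin.
have WY : (0 < W ^ 16)%N by rewrite expn_gt0 Wpos.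
have YN : (W ^ 16 <= N)%N by apply: leq_trans WN; rewrite leq_pexp2l // leq_pmulr.
have N0 : (0 < N)%N by apply: leq_trans YN.
set H := \sum_(1 <= n < N.+1) n%:R^-1 : R.
have HW : H <= 17%:R * k%:R * W%:R.
  apply: (le_trans (sum_inv_le_ln R N0)).
  have : ln (N%:R : R) <= (16 * k)%:R * W%:R.
    apply: (le_trans (ler_lnN R N0 (ltnW NW))).
    rewrite natrX lnXn // -[leLHS]mulr_natl ler_wpM2l // -natr1 addrC le_ln1Dx //.
    by apply: (lt_trans _ WR); rewrite oppr_lt0.
  rewrite natrM; have : 1 <= k%:R * W%:R :> R by apply: mulr_ege1.
  lra.
have H0 : 0 <= H by apply: sumr_ge0 => n _; rewrite invr_ge0.
have lamH : 2%:R * W%:R ^+ 8 * H <= (W ^ 16)%:R.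
  have -> : (W ^ 16)%:R = W%:R ^+ 8 * (W%:R ^+ 6 * (W%:R * W%:R)) :> R by rewrite natrX; ring.
  have W6 : 1 <= W%:R ^+ 6 :> R by rewrite exprn_ege1.
  rewrite mulrAC mulrC ler_wpM2l ?exprn_ge0 //.
  apply: (@le_trans _ _ (1 * (W%:R * W%:R))); last by rewrite ler_wpM2r // mulr_ge0.
  by rewrite mul1r; nra.
have tau sg : c * W%:R ^- 2 <= signed_sum R N (W ^ 16) (sg : {ffun A -> bool}).
  by apply: low; rewrite // ?WN // => p _; apply: norm_sign_of.
have lam0 : 0 <= W%:R ^+ 8 :> R by rewrite exprn_ge0.
have := sum_expR_signed_sum_le lam0 WY YN lamH NA tau.
set S := \sum_sg _; set e := expR _ => HS.
have cardE : #|{ffun A -> bool}|%:R = 2%:R ^+ #|` A| :> R.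
  by rewrite card_ffun card_bool cardfE natrX.
(* Markov's inequality: each bad pattern contributes at least [1] to [S]. *)
have bad_le : #|[pred sg : {ffun A -> bool} | signed_sum R N N sg < 0]|%:R <= S.
  rewrite -sum1_card natr_sum big_mkcond /=; apply: ler_sum => sg _.
  case: ifP => [neg|_]; last exact: expR_ge0.
  by rewrite -[leLHS]expR0 ler_expR oppr_ge0 mulr_ge0_le0 // ltW.
have p2 : 0 < 2%:R ^+ #|` A| :> R by rewrite exprn_gt0.
rewrite exprVn ler_pdivrMr // mulrC; apply: (le_trans bad_le); apply: (le_trans HS).
rewrite cardE ler_wpM2l ?(ltW p2) // ler_expR.
have -> : (2%:R * (W%:R ^+ 8) ^+ 2 * H ^+ 2 + W%:R ^+ 8 * H) / (W ^ 16)%:R -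
    W%:R ^+ 8 * (c * W%:R ^- 2) = 2%:R * H ^+ 2 + H / W%:R ^+ 8 - c * W%:R ^+ 6.
  by rewrite natrX; field; rewrite gt_eqF.
have HH : H ^+ 2 <= 289%:R * k%:R ^+ 2 * W%:R ^+ 2.
  have -> : 289%:R * k%:R ^+ 2 * W%:R ^+ 2 = (17%:R * k%:R * W%:R) ^+ 2 :> R by ring.
  by rewrite lerXn2r ?nnegrE // mulr_ge0 // mulr_ge0.
have HW8 : H / W%:R ^+ 8 <= 17%:R * k%:R.
  rewrite ler_pdivrMr ?exprn_gt0 //; apply: (le_trans HW).
  rewrite ler_wpM2l ?mulr_ge0 // -{1}[W%:R]expr1 ler_weXn2l //.
have hc4 : 600%:R * k%:R ^+ 2 * W%:R ^+ 2 <= c * W%:R ^+ 6.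
  have -> : c * W%:R ^+ 6 = c * W%:R * W%:R ^+ 3 * W%:R ^+ 2 by ring.
  rewrite ler_wpM2r ?exprn_ge0 //; apply: (le_trans hc).
  by rewrite ler_peMr ?exprn_ege1 // mulr_ge0 // ltW.
have kW : k%:R <= k%:R ^+ 2 * W%:R ^+ 2 :> R.
  rewrite -[leLHS]mulr1; apply: ler_pM => //; last exact: exprn_ege1.
  by rewrite expr2 ler_peMr.
have WkW : W%:R <= k%:R ^+ 2 * W%:R ^+ 2 :> R.
  rewrite -[leLHS]mul1r; apply: ler_pM => //; first exact: exprn_ege1.
  by rewrite expr2 ler_peMr.
rewrite -mulrA in HH; rewrite -mulrA in hc4.
have W1E : W.+1%:R = W%:R + 1 :> R by rewrite natr1.
rewrite W1E; move: HH HW8 hc4 kW WkW k1 W1.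
by clear; lra.
Qed.
End Tail.

Theorem theorem3 (R : realType)
  (Hmean : exists eps K : R, [/\ 0 < eps, 0 < K &
     forall (x : R) (h : nat -> R),
       3%:R <= x ->
       completely_multiplicative h ->
       (forall n : nat, (0 < n)%N -> `|h n| <= 1) ->
       (forall p : nat, prime p -> x `^ eps < p%:R -> h p = 0) ->
       `|sum_upto x h| <=
         K * (x / ln (ln x)) * expR (prime_sum_upto x (fun p => h p / p%:R))]) :
  exists alpha C : R, [/\ 0 < alpha, 0 < C &
    forall (d : measure_display) (T : measurableType d) (P : probability T R)
           (f : nat -> {RV P >-> R}),
      random_sign_cm f ->
      forall x : R, 1 <= x ->
        (prob_negative f x <= (C * expR (- (x `^ alpha)))%:E)%E].
Proof.
have [eps [K [eps0 K0 mean]]] := Hmean.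
have [k [c [W0 [k0 c0 low]]]] := smooth_log_sum_lower eps0 K0 mean.
have [W1 tail] := prob_negative_le_expR k0 c0 low.
have kR : 0 < (16 * k)%:R :> R by rewrite ltr0n muln_gt0.
(* This [alpha] gives [x^alpha <= W + 1], matching the tail bound; for [W < W1] the constant
   [exp W1] makes the right-hand side at least [1]. *)
exists ((16 * k)%:R^-1), (expR W1%:R); split; [by rewrite invr_gt0|exact: expR_gt0|].
move=> d T P f hf x x1; have x0 : 0 <= x by apply: le_trans x1.
have [W /andP[WN NW]] := @nat_root (16 * k) (Num.truncn x) (ltac:(by rewrite muln_gt0)).
have xW : x `^ (16 * k)%:R^-1 <= W.+1%:R.
  have -> : W.+1%:R = (W.+1%:R ^+ (16 * k)) `^ (16 * k)%:R^-1 :> R.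
    by rewrite -powR_mulrn // -powRrM divff ?gt_eqF // powRr1.
  apply: ge0_ler_powR; rewrite ?invr_ge0 ?nnegrE ?exprn_ge0 //.
  by rewrite (le_trans (ltW (truncnS_gt x))) // -natrX ler_nat.
rewrite -expRD; have [W1W|WW1] := leqP W1 W.
  apply: (le_trans (tail _ _ _ _ hf W x W1W x0 _)); first by rewrite WN NW.
  rewrite lee_fin ler_expR lerNl opprD opprK.
  by apply: le_trans xW; rewrite gerDr oppr_le0.
apply: (@le_trans _ _ 1%E); first exact/probability_le1/measurable_sum_neg.
by rewrite lee_fin -[leLHS]expR0 ler_expR subr_ge0 (le_trans xW) // ler_nat.
Qed.
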